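(* (Local exogeneity test based on bunching.) Let $\mathbb{P}$ be the class of models defined in the context, with $\mu(P)$ the aggregate discontinuity at $X=0$, and let $n\ge1$ be the sample size. For every $m\in\mathbb{R}$ let $\mathbb{P}_{0,m}=\{P\in\mathbb{P}:\mu(P)=m\}$ and $\mathbb{P}_{1,m}=\mathbb{P}\setminus\mathbb{P}_{0,m}$. Then for every $m\in\mathbb{R}$ and every $Q\in\mathbb{P}_{1,m}$ there is a sequence in the convex hull of $\{P^{\otimes n}:P\in\mathbb{P}_{0,m}\}$ converging in distribution to $Q^{\otimes n}$. Consequently: (i) for every $m\in\mathbb{R}$, every test $\phi_m(Z)$ for the value $m$ of the aggregate discontinuity that is a.s. continuous under $Q^{\otimes n}$ for every $Q\in\mathbb{P}_{1,m}$ has power limited by size: $\sup_{Q\in\mathbb{P}_{1,m}}\mathbb{E}_{Q^{\otimes n}}[\phi_m]\le\sup_{P\in\mathbb{P}_{0,m}}\mathbb{E}_{P^{\otimes n}}[\phi_m]$; (ii) every confidence set $C(Z)\subseteq\mathbb{R}$ for the value of the aggregate discontinuity $\mu(P)$ that has finite expected length has zero confidence level: $\inf_{P\in\mathbb{P}}P^{\otimes n}[\mu(P)\in C(Z)]=0$.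
   Context: Let $\mathbb{X}\subseteq\mathbb{R}$ with $[0,\delta)\subset\mathbb{X}$ for some $\delta>0$, and let $\mathbb{W}$ be a subset of a Euclidean space. $\mathcal{G}$ is the set of bounded functions $g:\mathbb{X}\times\mathbb{W}\to\mathbb{R}$ that are infinitely many times continuously differentiable with respect to $x$ on $(\mathbb{X}\setminus\{0\})\times\mathbb{W}$ and for which $\lim_{x\downarrow0}g(x,w)$ exists for every $w\in\mathbb{W}$; the size of the discontinuity at $x=0$ may take any value in $\mathbb{R}$. $\mathbb{P}$ is the set of all distributions $P$ of $Z_i=(X_i,W_i,Y_i)$, with $X_i,Y_i$ real-valued, such that: $(X_i,W_i)$ has support $\mathbb{X}\times\mathbb{W}$; the distribution of $X_i$ has non-zero probability at $0$ but is continuous otherwise; the conditional distribution of $Y_i$ given $(X_i,W_i)$ is continuous; and there is $g\in\mathcal{G}$ with $\mathbb{E}_P[Y_i\mid X_i=x,W_i=w]=g(x,w)$. Define $\tau_P(w)=\mathbb{E}_P[Y_i\mid X_i=0,W_i=w]-\lim_{x\downarrow0}\mathbb{E}_P[Y_i\mid X_i=x,W_i=w]$ (computed with the version $g$) and $\mu(P)=\big[\mathbb{E}_P(\tau_P(W_i)^2)\big]^{1/2}$. The data are $Z=(Z_1,\dots,Z_n)$, i.i.d. with distribution $P$, so $Z\sim P^{\otimes n}$. A test is a measurable function of $Z$ with values in $[0,1]$; it is a.s. continuous under a distribution if its set of discontinuity points has probability zero under that distribution. The convex hull of a set of distributions is the set of finite mixtures of its elements. A confidence set is a set-valued function $C(Z)$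 of the data; its length is $\sup C(Z)-\inf C(Z)$, and finite expected length means that the expectation of the length is finite under every $P\in\mathbb{P}$.
   Formalization: The approximation claim and (i) are stated for m ≥ 0 only: for m < 0 no model has μ(P) = m, since μ is a square root, so both fail whenever the class of models is nonempty; (ii) assumes that the class of models is nonempty. *)

(* Defs.v *)
From HB Require Import structures.
From mathcomp Require Import all_boot all_order all_algebra.
From mathcomp Require Import all_classical all_reals all_analysis.

Set Implicit Arguments.
Unset Strict Implicit.
Unset Printing Implicit Defensive.

Import Order.TTheory GRing.Theory Num.Theory.
Import numFieldNormedType.Exports.

Local Open Scope classical_set_scope.
Local Open Scope ring_scope.

(* The library gives [n.-tuple T] the product sigma-algebra but no topology;
   the product topology is added here, so that [d.-tuple R] stands for
   d-dimensional Euclidean space with its Borel sets and [n.-tuple T] for the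
   space of samples of size n. *)
Definition tuple_coords (n : nat) (T : Type) (t : n.-tuple T) :
  prod_topology (fun _ : 'I_n => T) := fun i => tnth t i.

HB.instance Definition _ (n : nat) (T : topologicalType) :=
  Topological.copy (n.-tuple T) (initial_topology (@tuple_coords n T)).

Section product_probability.
Context {d : measure_display} {T : measurableType d} {R : realType}.

Definition tuple_cons (n : nat) (x : T * n.-tuple T) : n.+1.-tuple T :=
  [tuple of x.1 :: x.2].

Lemma measurable_tuple_cons (n : nat) :
  measurable_fun [set: T * n.-tuple T] (@tuple_cons n).
Proof. exact: measurable_cons. Qed.

HB.instance Definition _ (n : nat) :=
  isMeasurableFun.Build _ _ _ _ (@tuple_cons n) (@measurable_tuple_cons n).

Fixpoint power_probability (P : probability T R) (n : nat) :
    probability (n.-tuple T) R :=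
  match n with
  | 0 => [the probability _ _ of dirac ([tuple] : 0.-tuple T)]
  | n'.+1 => [the probability _ _ of
      distribution [the probability _ _ of (P \x power_probability P n')%E]
        (@tuple_cons n')]
  end.

Lemma power_probability_rect (P : probability T R) (n : nat)
    (A : 'I_n -> set T) :
  (forall i, measurable (A i)) ->
  power_probability P n [set t | forall i, A i (tnth t i)] =
  (\prod_(i < n) P (A i))%E.
Proof.
elim: n A => [|n IHn] A mA.
  rewrite big_ord0 /= diracE mem_set//= => -[]//.
rewrite big_ord_recl /= /distribution /pushforward.
rewrite -IHn; last by move=> i; exact: mA.
rewrite -product_measure1E//; last first.
  rewrite (_ : mkset _ = \bigcap_(i in [set: 'I_n])
      ((@tnth n T)^~ i @^-1` A (lift ord0 i))); last first.
    by apply/seteqP; split=> t /= h i => [_|]; exact: h.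
  apply: fin_bigcap_measurable => // i _; rewrite -[X in measurable X]setTI.
  exact: measurable_tnth.
congr (product_measure1 _ _ _); apply/seteqP; split=> -[x t] /=.
  move=> h; split=> [|i]; first exact: h ord0.
  by have := h (lift ord0 i); rewrite /tuple_cons/= tnthS.
move=> [h0 h] i; have [j ->|->//] := unliftP ord0 i.
by rewrite /tuple_cons/= tnthS.
Qed.

Definition convex_hull (A : set (probability T R)) : set (probability T R) :=
  [set nu | exists (k : nat) (a : 'I_k -> R) (mu : 'I_k -> probability T R),
    [/\ forall i, 0 <= a i, \sum_(i < k) a i = 1, forall i, A (mu i) &
        forall B, measurable B ->
          nu B = (\sum_(i < k) (a i)%:E * mu i B)%E]].

End product_probability.

(* [mu] is concentrated on [S] and charges every nonempty relatively open
   subset of [S], i.e. its topological support relative to [S] is all of [S].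
   For closed [S] this says that the topological support of [mu] is [S]; the
   relative form also makes sense for sets such as [0, delta) that are not
   closed. *)
Definition has_support {R : realType} {dT : nat}
    (mu : set (R * dT.-tuple R) -> \bar R) (S : set (R * dT.-tuple R)) :=
  [/\ measurable S, mu S = 1%E &
      forall U, open U -> U `&` S !=set0 -> (0 < mu U)%E].

(* Infinitely differentiable on an arbitrary [S] (derivatives relative to [S]);
   [D k] is the k-th derivative, and its continuity relative to [S] follows
   from its differentiability. *)
Definition smooth_on {R : realType} (S : set R) (f : R -> R) :=
  exists D : nat -> R -> R,
    (forall x, S x -> D 0%N x = f x) /\
    (forall k x, S x ->
       (D k y - D k x) / (y - x) @[y --> within S x^'] --> D k.+1 x).

Section model.
Context {R : realType} {d : nat}.

(* Observations are encoded as z = ((x, w), y). *)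
Local Notation obs := (R * d.-tuple R * R)%type.

Implicit Types (X : set R) (W : set (d.-tuple R)) (P : probability obs R)
  (g : R * d.-tuple R -> R).

(* Only the values of [g] on [X `*` W] matter. *)
Definition regressions X W : set (R * d.-tuple R -> R) :=
  [set g | [/\ exists M : R, forall v, (X `*` W) v -> `|g v| <= M,
               forall w, W w -> smooth_on (X `\ 0) (fun x => g (x, w)) &
               forall w, W w -> cvg (g (x, w) @[x --> 0^'+])]].

(* E_P[Y | X = x, W = w] = g(x, w), for (X, W) concentrated on [X `*` W] *)
Definition is_regression X W P g :=
  [/\ P.-integrable setT (fun z => z.2%:E),
      measurable_fun (X `*` W) g &
      forall A, measurable A -> A `<=` X `*` W ->
        (\int[P]_(z in fst @^-1` A) z.2%:E =
         \int[P]_(z in fst @^-1` A) (g z.1)%:E)%E].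

Definition continuous_conditional P :=
  exists k : R.-pker (R * d.-tuple R) ~> R,
    (forall A B, measurable A -> measurable B ->
       P (A `*` B) = (\int[P]_(z in fst @^-1` A) k z.1 B)%E) /\
    {ae P, forall z, forall y, k z.1 [set y] = 0%E}.

Definition version X W P g := regressions X W g /\ is_regression X W P g.

Definition models X W : set (probability obs R) :=
  [set P : probability obs R | [/\ has_support (pushforward P fst) (X `*` W),
               (0 < P [set z : obs | z.1.1 = 0%R])%E /\
               (forall x : R, x != 0 -> P [set z : obs | z.1.1 = x] = 0%E),
               continuous_conditional P &
               exists g, version X W P g]].

Definition jump_at_zero g (w : d.-tuple R) : R :=
  g (0, w) - lim (g (x, w) @[x --> 0^'+]).

Definition aggregate_discontinuity W g P : R :=
  Num.sqrt (\int[P]_(z in [set z : obs | W z.1.2]) (jump_at_zero g z.1.2 ^+ 2)).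

(* Under P in [models X W], a version of E_P[Y | X = x, W = w] is unique only
   almost everywhere, so mu(P) is defined relative to a choice [g] of one
   version [g P] for each model P. *)
Definition null_models X W (g : probability obs R -> R * d.-tuple R -> R)
    (m : R) : set (probability obs R) :=
  [set P : probability obs R | models X W P /\ aggregate_discontinuity W (g P) P = m].

Definition alt_models X W (g : probability obs R -> R * d.-tuple R -> R)
    (m : R) := models X W `\` null_models X W g m.

End model.

Section samples.
Context {R : realType} {d n : nat}.
Local Notation sample := (n.-tuple (R * d.-tuple R * R)).

Definition cvg_in_distribution (u : nat -> probability sample R)
    (mu : probability sample R) :=
  forall f : sample -> R, continuous f -> (exists M : R, forall z, `|f z| <= M) ->
    ('E_(u k)[f])%E @[k --> \oo] --> ('E_mu[f])%E.

Definition is_test (phi : sample -> R) :=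
  measurable_fun setT phi /\ (forall z, 0 <= phi z <= 1).

Definition as_continuous (mu : probability sample R) (phi : sample -> R) :=
  mu.-negligible [set z | ~ {for z, continuous phi}].

End samples.

(* sup S - inf S; the maximum only matters for the empty set, which has
   length 0. *)
Definition set_length {R : realType} (S : set R) : \bar R :=
  maxe 0%E (ereal_sup (EFin @` S) - ereal_inf (EFin @` S))%E.

Definition is_confidence_set {R : realType} {d n : nat}
    (C : n.-tuple (R * d.-tuple R * R) -> set R) :=
  forall m, measurable [set z | C z m].

(* Main.v *)
Require Import Defs.
From HB Require Import structures.
From mathcomp Require Import all_boot all_order all_algebra.
From mathcomp Require Import all_classical all_reals all_analysis.
From mathcomp Require Import measurable_realfun giry lra ring.
Set Implicit Arguments.
Unset Strict Implicit.
Unset Printing Implicit Defensive.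
Import Order.TTheory GRing.Theory Num.Theory.
Import numFieldNormedType.Exports.
Local Open Scope classical_set_scope.
Local Open Scope ring_scope.

(* Let Q be a model and let g be a version of E_Q[Y | X, W], with jump J(w) at
   x = 0.  Shift Y by J(W) + m with probability exp(-kX) on {X > 0}: the
   regression function becomes g(x, w) + exp(-kx) (J(w) + m) for x > 0, which is
   still smooth away from 0 and jumps by -m at 0 for every w, while Q moves in
   total variation by at most E_Q[exp(-kX); X > 0], which tends to 0.

   Versions are unique only almost everywhere, and Q need not charge {0} x W and
   its right neighbourhoods enough to determine the jump for almost all w.  So
   the law of (X, W) is also mixed with a small multiple of L x law(W), where L
   ([boundary_law]) has an atom at 0 and charges every interval ]0, r[; then
   every version jumps by -m almost surely.  The conditional law of Y is left unchanged only on a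
   set E of large probability where its first moment is bounded, since otherwise
   this mixture might destroy the integrability of Y.

   Hence every model is a limit in total variation of models with aggregate
   discontinuity m.  This gives the convergence in distribution and (i).  For
   (ii), if all coverage probabilities are at least c > 0, then
   Q^n[j in C(Z)] >= c / 2 for every integer j, so with probability at least
   c / 2 the set C(Z) contains arbitrarily large integers and has infinite
   length. *)

(** * Total variation bounds *)

Section total_variation.
Context {d} {T : measurableType d} {R : realType}.
Implicit Types P Q : probability T R.

(** Test functions with values in [0, 1], rather than events, let the bound be integrated one
    coordinate at a time in product spaces. The one-sided form loses nothing: replacing [h] by
    [1 - h] exchanges [P] and [Q]. *)
Definition tv_le P Q (e : R) := forall h : T -> \bar R,
  measurable_fun [set: T] h -> (forall x, 0 <= h x <= 1)%E ->
  (\int[P]_x h x <= \int[Q]_x h x + e%:E)%E.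

Lemma integral_prob_le1 P (h : T -> \bar R) : measurable_fun [set: T] h ->
  (forall x, 0 <= h x <= 1)%E -> (0 <= \int[P]_x h x <= 1)%E.
Proof.
move=> mh h01; apply/andP; split.
  by apply: integral_ge0 => x _; case/andP: (h01 x).
have -> : 1%E = (\int[P]_x (cst 1 x))%E.
  by rewrite integral_cst//= probability_setT mule1.
apply: ge0_le_integral => // x _; by case/andP: (h01 x).
Qed.

Lemma integral_prob_onem P (h : T -> \bar R) : measurable_fun [set: T] h ->
  (forall x, 0 <= h x <= 1)%E ->
  (\int[P]_x h x + \int[P]_x (1 - h x) = 1)%E.
Proof.
move=> mh h01.
have hfin x : h x \is a fin_num.
  have /andP[h0 h1] := h01 x; rewrite ge0_fin_numE//.
  by rewrite (le_lt_trans h1)// ltry.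
rewrite -ge0_integralD//=; last 3 first.
- by move=> x _; case/andP: (h01 x).
- by move=> x _; have /andP[_ h1] := h01 x; rewrite sube_ge0 ?hfin.
- exact: emeasurable_funB.
rewrite (eq_integral (cst 1%E)); last by move=> x _; rewrite addeC subeK.
by rewrite integral_cst//= probability_setT mule1.
Qed.

Lemma tv_le_sym P Q e : tv_le P Q e -> tv_le Q P e.
Proof.
move=> PQ h mh h01.
have mh' : measurable_fun [set: T] (fun x => 1 - h x)%E by exact: emeasurable_funB.
have h01' x : (0 <= 1 - h x <= 1)%E.
  have /andP[h0 h1] := h01 x; apply/andP; split.
    by rewrite sube_ge0 ?orbT.
  by rewrite geeDl// oppe_le0.
have := PQ _ mh' h01'.
have := integral_prob_onem P mh h01; have := integral_prob_onem Q mh h01.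
have := integral_prob_le1 P mh h01; have := integral_prob_le1 Q mh h01.
have := integral_prob_le1 P mh' h01'; have := integral_prob_le1 Q mh' h01'.
move: (\int[P]_x h x)%E (\int[P]_x (1 - h x))%E.
move: (\int[Q]_x h x)%E (\int[Q]_x (1 - h x))%E.
move=> [a| |]// [b| |]// [a'| |]// [b'| |]//.
rewrite -!EFinD !lee_fin; do 4 move=> /andP[? ?].
by move=> [] ? [] ? ?; lra.
Qed.

Lemma tv_le_measure P Q e (A : set T) : tv_le P Q e -> measurable A ->
  (P A <= Q A + e%:E)%E.
Proof.
move=> PQ mA; have := PQ (EFin \o \1_A).
rewrite !integral_indic// !setIT; apply; first exact/measurable_EFinP.
by move=> x /=; rewrite indicE lee_fin lee_fin; case: (x \in A); rewrite ?ler01 ?lexx.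
Qed.

Import HBNNSimple.

(** The integral of a nonnegative [f] is the supremum over simple functions below it, measurable or
    not. Each such simple function divided by [M] has values in [0, 1], and the bound passes to the
    supremum. *)
Lemma tv_le_ge0_integral P Q e (M : R) (f : T -> \bar R) : tv_le P Q e -> 0 < M ->
  (forall x, 0 <= f x <= M%:E)%E ->
  (\int[P]_x f x <= \int[Q]_x f x + (M * e)%:E)%E.
Proof.
move=> PQ M0 fM; have f0 x : (0 <= f x)%E by case/andP: (fM x).
rewrite [leLHS]ge0_integralTE//; apply: ge_ereal_sup => _ [h hf <-].
rewrite -integralT_nnsfun.
have Mh x : ((h x)%:E = M%:E * (M^-1 * h x)%:E)%E.
  by rewrite -EFinM mulVKf ?gt_eqF.
have mh : measurable_fun [set: T] (fun x => (M^-1 * h x)%:E).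
  by apply/measurable_EFinP; exact: measurable_funM.
have h01 x : (0 <= (M^-1 * h x)%:E <= 1)%E.
  rewrite !lee_fin mulr_ge0 ?invr_ge0 ?(ltW M0)//=.
  rewrite ler_pdivrMl// mulr1 -lee_fin (le_trans (hf x))//.
  by case/andP: (fM x).
have h0 x : (0 <= (M^-1 * h x)%:E)%E by case/andP: (h01 x).
have hM (N : probability T R) :
    (\int[N]_x (h x)%:E = M%:E * \int[N]_x (M^-1 * h x)%:E)%E.
  under eq_integral do rewrite Mh.
  by rewrite ge0_integralZl_EFin// ltW.
have hQ : (\int[Q]_x (h x)%:E <= \int[Q]_x f x)%E.
  rewrite [leRHS]ge0_integralTE//; apply: ereal_sup_ubound.
  by exists h => //; rewrite -integralT_nnsfun.
apply: le_trans (leeD2r _ hQ); rewrite !hM EFinM -muleDr ?fin_num_adde_defl//.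
by rewrite lee_pmul2l ?lte_fin//; exact: PQ.
Qed.

Lemma ge0_integral_bounded P (M : R) (h : T -> \bar R) :
  (forall x, 0 <= h x <= M%:E)%E ->
  exists2 r, (\int[P]_x h x = r%:E)%E & 0 <= r <= M.
Proof.
move=> hM; have h0 x : (0 <= h x)%E by case/andP: (hM x).
suff: (0 <= \int[P]_x h x <= M%:E)%E.
  case: (\int[P]_x h x)%E => [r| |]; first by exists r.
    by rewrite leye_eq andbF.
  by rewrite leeNy_eq.
rewrite integral_ge0//= ge0_integralTE//; apply: ge_ereal_sup => _ [k hk <-].
rewrite -integralT_nnsfun.
rewrite (@le_trans _ _ (\int[P]_x M%:E)%E)//.
  apply: ge0_le_integral => //.
  - by move=> x _; rewrite lee_fin.
  - exact/measurable_EFinP.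
  by move=> x _; rewrite (le_trans (hk x))//; case/andP: (hM x).
by rewrite integral_cst//= probability_setT mule1.
Qed.

Lemma funepos_bounded (M : R) (f : T -> R) : (forall x, `|f x| <= M) ->
  forall x, (0 <= (EFin \o f)^\+ x <= M%:E)%E.
Proof.
move=> fM x; have M0 : 0 <= M := le_trans (normr_ge0 _) (fM x).
rewrite funepos_ge0/= funeposE/= ge_max/= !lee_fin M0 andbT.
by rewrite (le_trans (ler_norm _)).
Qed.

Lemma funeneg_bounded (M : R) (f : T -> R) : (forall x, `|f x| <= M) ->
  forall x, (0 <= (EFin \o f)^\- x <= M%:E)%E.
Proof.
move=> fM x; have M0 : 0 <= M := le_trans (normr_ge0 _) (fM x).
rewrite funeneg_ge0/= funenegE/= ge_max/= !lee_fin M0 andbT.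
by rewrite (le_trans (ler_norm _))// normrN.
Qed.

Lemma expectation_bounded_fin_num P (M : R) (f : T -> R) :
  (forall x, `|f x| <= M) -> ('E_P[f] \is a fin_num)%E.
Proof.
move=> fM; rewrite unlock integralE.
have [r1 -> _] := ge0_integral_bounded P (funepos_bounded fM).
by have [r2 -> _] := ge0_integral_bounded P (funeneg_bounded fM).
Qed.

(* [f] need not be measurable, which spares relating the Borel sets of the
   product topology on samples to the product sigma-algebra. *)
Lemma tv_le_expectation P Q e (M : R) (f : T -> R) : tv_le P Q e -> 0 < M ->
  0 <= e -> (forall x, `|f x| <= M) ->
  ('E_P[f] <= 'E_Q[f] + (M * e *+ 2)%:E)%E.
Proof.
move=> PQ M0 e0 fM; rewrite unlock [leLHS]integralE [in leRHS]integralE.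
have fpM := funepos_bounded fM; have fnM := funeneg_bounded fM.
have := tv_le_ge0_integral PQ M0 fpM.
have := tv_le_ge0_integral (tv_le_sym PQ) M0 fnM.
have [r1 -> ?] := ge0_integral_bounded P fpM; have [r2 -> ?] := ge0_integral_bounded P fnM.
have [r3 -> ?] := ge0_integral_bounded Q fpM; have [r4 -> ?] := ge0_integral_bounded Q fnM.
by rewrite -!EFinD !lee_fin mulr2n; lra.
Qed.

End total_variation.

(** * Total variation between powers of probability measures *)

Section tensor_power.
Context {d} {T : measurableType d} {R : realType}.
Implicit Types P Q : probability T R.

Lemma integral_power_probabilityS P n (h : n.+1.-tuple T -> \bar R) :
  measurable_fun [set: n.+1.-tuple T] h -> (forall t, 0 <= h t)%E ->
  (\int[power_probability P n.+1]_t h t =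
   \int[P]_x \int[power_probability P n]_t h (tuple_cons (x, t)))%E.
Proof.
move=> mh h0.
rewrite [LHS]ge0_integral_distribution//.
rewrite fubini_tonelli1//; last by move=> z; exact: h0.
by apply: measurableT_comp mh _; exact: measurable_tuple_cons.
Qed.

Lemma measurable_integral_tuple_cons P n (h : n.+1.-tuple T -> \bar R) :
  measurable_fun [set: n.+1.-tuple T] h -> (forall t, 0 <= h t)%E ->
  measurable_fun [set: T]
    (fun x => \int[power_probability P n]_t h (tuple_cons (x, t)))%E.
Proof.
move=> mh h0.
apply: (@measurable_fun_fubini_tonelli_F _ _ _ _ _ (power_probability P n)
  (h \o @tuple_cons _ _ n)); last by move=> z; exact: h0.
by apply: measurableT_comp mh _; exact: measurable_tuple_cons.
Qed.

(** Coordinates are exchanged one at a time: the induction hypothesis replaces [P] by [Q] in the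
    last [n] coordinates at cost [e *+ n], and the first coordinate then costs one more [e]. *)
Lemma tv_le_power P Q e n : 0 <= e -> tv_le P Q e ->
  tv_le (power_probability P n) (power_probability Q n) (e *+ n).
Proof.
move=> e0 PQ; elim: n => [|n IHn] h mh h01.
  by rewrite mulr0n adde0.
have h0 t : (0 <= h t)%E by case/andP: (h01 t).
rewrite !integral_power_probabilityS//.
pose F (N : probability T R) x :=
  (\int[power_probability N n]_t h (tuple_cons (x, t)))%E.
have mF N : measurable_fun [set: T] (F N) by exact: measurable_integral_tuple_cons.
have mcons x : measurable_fun [set: n.-tuple T] (fun t => h (tuple_cons (x, t))).
  apply: measurableT_comp mh _.
  apply: measurableT_comp (@measurable_tuple_cons _ _ n) _.
  exact: measurable_pair1.
have F01 N x : (0 <= F N x <= 1)%E by exact: integral_prob_le1.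
have F0 N x : (0 <= F N x)%E by case/andP: (F01 N x).
have en0 : 0 <= e *+ n by rewrite mulrn_wge0.
rewrite (@le_trans _ _ (\int[P]_x (F Q x + (e *+ n)%:E))%E)//.
  apply: ge0_le_integral => //.
  - by move=> x _; exact: F0.
  - exact: mF.
  - by apply: emeasurable_funD.
  - by move=> x _; exact: IHn.
rewrite ge0_integralD//=.
rewrite integral_cst//= probability_setT mule1 mulrS EFinD addeA.
by rewrite leeD2r//; exact: PQ.
Qed.

Lemma convex_hull1 (A : set (probability T R)) P : A P -> convex_hull A P.
Proof.
move=> AP; exists 1%N, (fun=> 1), (fun=> P); split=> //.
- by rewrite big_ord_recl big_ord0 addr0.
- by move=> B mB; rewrite big_ord_recl big_ord0 adde0 mul1e.
Qed.

End tensor_power.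

(** * Convergence in distribution from total variation bounds *)

Section cvg.
Context {R : realType} {d n : nat}.
Local Notation sample := (n.-tuple (R * d.-tuple R * R)).

Lemma tv_le_cvg_in_distribution (u : nat -> probability sample R)
    (mu : probability sample R) (e : nat -> R) :
  (forall k, 0 <= e k) -> (forall k, tv_le (u k) mu (e k)) ->
  e k @[k --> \oo] --> 0 -> cvg_in_distribution u mu.
Proof.
move=> e0 tve cve f _ [M fM].
have [M' M'0 fM'] : exists2 M', 0 < M' & forall z, `|f z| <= M'.
  exists (Num.max M 1); first by rewrite lt_max ltr01 orbT.
  by move=> z; rewrite le_max fM.
have Ef (N : probability sample R) : ('E_N[f] \is a fin_num)%E.
  exact: expectation_bounded_fin_num fM.
have ub k := tv_le_expectation (tve k) M'0 (e0 k) fM'.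
have lb k := tv_le_expectation (tv_le_sym (tve k)) M'0 (e0 k) fM'.
have cvM : (M' * e k *+ 2) @[k --> \oo] --> 0.
  rewrite (_ : 0 = M' * 0 *+ 2); last by rewrite mulr0 mul0rn.
  under eq_fun do rewrite -mulr_natr.
  rewrite -mulr_natr; apply: cvgMr_tmp; exact: cvgMl_tmp.
have cvME : (M' * e k *+ 2)%:E @[k --> \oo] --> 0%E.
  by apply/fine_cvgP; split; [exact: nearW|exact: cvM].
apply: (@squeeze_cvge _ _ _ _ (fun k => 'E_mu[f] - (M' * e k *+ 2)%:E)%E _
    (fun k => 'E_mu[f] + (M' * e k *+ 2)%:E)%E).
- by apply: nearW => k; rewrite ub leeBlDr// lb.
- rewrite -[X in _ --> X]sube0; apply: cvgeB; [by rewrite fin_num_adde_defl| |exact: cvME].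
  exact: cvg_cst.
- rewrite -[X in _ --> X]adde0; apply: cvgeD; [by rewrite fin_num_adde_defl| |exact: cvME].
  exact: cvg_cst.
Qed.

End cvg.

(** * Mixtures, kernels and disintegration *)

Section as_probability.
Context {d} {T : measurableType d} {R : realType}.
Variables (m : {measure set T -> \bar R}) (m1 : m [set: T] = 1%E).

(** An alias of [m] on which a probability structure is declared from the hypothesis [m1]. *)
Definition as_probability_fun : set T -> \bar R := m.

HB.instance Definition _ := Measure.on as_probability_fun.
HB.instance Definition _ :=
  Measure_isProbability.Build _ _ _ as_probability_fun m1.

Definition as_probability : probability T R := as_probability_fun.

End as_probability.

Section mixture.
Context {d} {T : measurableType d} {R : realType}.
Variables (a : R) (a0 : 0 <= a) (a1 : 0 <= 1 - a) (P Q : probability T R).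

Let mixture_measure : {measure set T -> \bar R} :=
  measure_add (mscale (NngNum a0) P) (mscale (NngNum a1) Q).

Let mixture_measureE A :
  mixture_measure A = (a%:E * P A + (1 - a)%:E * Q A)%E.
Proof. exact: (measure_addE (mscale (NngNum a0) P) (mscale (NngNum a1) Q)). Qed.

Let mixture_setT : mixture_measure [set: T] = 1%E.
Proof.
by rewrite mixture_measureE !probability_setT !mule1 -EFinD addrC subrK.
Qed.

Definition mixture : probability T R := as_probability mixture_setT.

Lemma mixtureE A : mixture A = (a%:E * P A + (1 - a)%:E * Q A)%E.
Proof. exact: mixture_measureE. Qed.

Lemma integral_mixture (h : T -> \bar R) :
  measurable_fun [set: T] h -> (forall x, 0 <= h x)%E ->
  (\int[mixture]_x h x = a%:E * \int[P]_x h x + (1 - a)%:E * \int[Q]_x h x)%E.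
Proof.
move=> mh h0.
rewrite [LHS](ge0_integral_measure_add (mscale (NngNum a0) P)
  (mscale (NngNum a1) Q))//.
by rewrite !ge0_integral_mscale.
Qed.

End mixture.

Section family_kernel.
Context {d1 d2} {T1 : measurableType d1} {T2 : measurableType d2} {R : realType}.
Variables (k : T1 -> probability T2 R).
Hypothesis mk : forall B, measurable B -> measurable_fun [set: T1] (k ^~ B).

Definition family_kernel_fun (x : T1) : {measure set T2 -> \bar R} := k x.

Let family_kernel_setT x : family_kernel_fun x [set: T2] = 1%E.
Proof. exact: probability_setT. Qed.

HB.instance Definition _ := isKernel.Build _ _ _ _ _ family_kernel_fun mk.
HB.instance Definition _ :=
  Kernel_isProbability.Build _ _ _ _ _ family_kernel_fun family_kernel_setT.

Definition family_kernel : R.-pker T1 ~> T2 := family_kernel_fun.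

Lemma measurable_kernel_xsection (A : set (T1 * T2)) : measurable A ->
  measurable_fun [set: T1] (fun x => k x (xsection A x)).
Proof.
by move=> mA; apply: (measurable_fun_xsection_finite_kernel family_kernel);
  rewrite inE.
Qed.

End family_kernel.

Section joint.
Context {d1 d2} {T1 : measurableType d1} {T2 : measurableType d2} {R : realType}.
Variables (mu : probability T1 R) (k : T1 -> probability T2 R).
Hypothesis mk : forall B, measurable B -> measurable_fun [set: T1] (k ^~ B).

(** The law of [(x, y)] for fixed [x] and [y] drawn from [k x]. Binding [mu] with this family in the
    Giry monad gives the joint law, so its integrals come from the monad. *)
Let slice (x : T1) : giry (T1 * T2)%type R :=
  giry_map (measurable_pair1 x) (k x).

Let measurable_slice : measurable_fun [set: T1] slice.
Proof.
apply: measurable_giry_codensity => // B mB.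
have := measurable_kernel_xsection mk mB.
by under eq_fun do rewrite xsectionE.
Qed.

Let joint_measure := giry_bind mu measurable_slice.

Let integral_joint_measure (h : T1 * T2 -> \bar R) :
  measurable_fun [set: T1 * T2] h -> (forall z, 0 <= h z)%E ->
  (\int[joint_measure]_z h z = \int[mu]_x \int[k x]_y h (x, y))%E.
Proof.
move=> mh h0; rewrite [LHS]giry_int_bind//.
by apply: eq_integral => x _; rewrite [LHS]giry_int_map.
Qed.

Let joint_setT : joint_measure [set: T1 * T2] = 1%E.
Proof.
rewrite -[LHS]mul1e -integral_cst// integral_joint_measure//.
under eq_integral do rewrite integral_cst//= probability_setT mule1.
by rewrite integral_cst//= probability_setT mule1.
Qed.

Definition joint : probability (T1 * T2)%type R := as_probability joint_setT.

Lemma integral_joint (h : T1 * T2 -> \bar R) :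
  measurable_fun [set: T1 * T2] h -> (forall z, 0 <= h z)%E ->
  (\int[joint]_z h z = \int[mu]_x \int[k x]_y h (x, y))%E.
Proof. exact: integral_joint_measure. Qed.

Lemma measurable_integral_kernel (h : T1 * T2 -> \bar R) :
  measurable_fun [set: T1 * T2] h -> (forall z, 0 <= h z)%E ->
  measurable_fun [set: T1] (fun x => \int[k x]_y h (x, y))%E.
Proof.
move=> mh h0.
have -> : (fun x => \int[k x]_y h (x, y))%E = (giry_int ^~ h) \o slice.
  by apply/funext => x; rewrite [RHS]giry_int_map.
by apply: measurableT_comp measurable_slice; exact: measurable_giry_int.
Qed.

End joint.

Section law.
Context {d1 d2} {T1 : measurableType d1} {T2 : measurableType d2} {R : realType}.
Variables (f : T1 -> T2) (mf : measurable_fun [set: T1] f) (P : probability T1 R).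

Let law_setT : giry_map mf P [set: T2] = 1%E.
Proof. exact: probability_setT. Qed.

Definition law : probability T2 R := as_probability law_setT.

Lemma integral_law (h : T2 -> \bar R) :
  measurable_fun [set: T2] h -> (forall x, 0 <= h x)%E ->
  (\int[law]_y h y = \int[P]_x h (f x))%E.
Proof. by move=> mh h0; rewrite [LHS]giry_int_map. Qed.

End law.

Section joint_theory.
Context {d1 d2} {T1 : measurableType d1} {T2 : measurableType d2} {R : realType}.
Variables (mu : probability T1 R) (k : T1 -> probability T2 R).
Hypothesis mk : forall B, measurable B -> measurable_fun [set: T1] (k ^~ B).

Lemma jointE (C : set (T1 * T2)) : measurable C ->
  joint mu mk C = (\int[mu]_x k x (xsection C x))%E.
Proof.
move=> mC; rewrite -[C in LHS]setIT -integral_indic// integral_joint//; last first.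
  exact/measurable_EFinP.
apply: eq_integral => x _.
transitivity (\int[k x]_y (\1_(xsection C x) y)%:E)%E.
  by apply: eq_integral => y _; rewrite !indicE mem_xsection.
by rewrite integral_indic ?setIT//; exact: measurable_xsection.
Qed.

Lemma joint_setX (A : set T1) (B : set T2) : measurable A -> measurable B ->
  joint mu mk (A `*` B) = (\int[mu]_(x in A) k x B)%E.
Proof.
move=> mA mB; rewrite jointE; last exact: measurableX.
rewrite [RHS]integral_mkcond; apply: eq_integral => x _; rewrite patchE.
case: ifPn => xA; first by rewrite in_xsectionX.
by rewrite notin_xsectionX// measure0.
Qed.

Lemma joint_fst (A : set T1) : measurable A ->
  joint mu mk (fst @^-1` A) = mu A.
Proof.
move=> mA.
have -> : fst @^-1` A = A `*` [set: T2] by apply/seteqP; split=> -[] //= ? ? [].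
rewrite joint_setX//.
under eq_integral do rewrite probability_setT.
by rewrite integral_cst// mul1e.
Qed.

Lemma integral_joint_fst (h : T1 -> \bar R) :
  measurable_fun [set: T1] h -> (forall x, 0 <= h x)%E ->
  (\int[joint mu mk]_z h z.1 = \int[mu]_x h x)%E.
Proof.
move=> mh h0; rewrite integral_joint//; last exact: measurableT_comp.
apply: eq_integral => x _.
by rewrite (eq_integral (cst (h x)))// integral_cst//= probability_setT mule1.
Qed.

(** Fubini for a kernel: the nonnegative case is applied to the positive and negative parts of [h],
    whose inner integrals are integrable for [mu], and the results are subtracted. *)
Lemma integral_joint_integrable (h : T1 * T2 -> \bar R) :
  (joint mu mk).-integrable [set: T1 * T2] h ->
  (forall x, (k x).-integrable [set: T2] (fun y => h (x, y))) ->
  mu.-integrable [set: T1] (fun x => \int[k x]_y h (x, y))%E /\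
  (\int[joint mu mk]_z h z = \int[mu]_x \int[k x]_y h (x, y))%E.
Proof.
move=> ih ihk.
have mh := measurable_int _ ih.
have mhp := measurable_funepos mh; have mhn := measurable_funeneg mh.
have ip : mu.-integrable [set: T1] (fun x => \int[k x]_y h^\+ (x, y))%E.
  apply/integrableP; split; first exact: measurable_integral_kernel.
  under eq_integral => x _ do rewrite gee0_abs ?integral_ge0//.
  rewrite -(integral_joint mu mk)//.
  have /integrableP[_] := integrable_funepos measurableT ih.
  by under eq_integral => x _ do rewrite gee0_abs//.
have in_ : mu.-integrable [set: T1] (fun x => \int[k x]_y h^\- (x, y))%E.
  apply/integrableP; split; first exact: measurable_integral_kernel.
  under eq_integral => x _ do rewrite gee0_abs ?integral_ge0//.
  rewrite -(integral_joint mu mk)//.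
  have /integrableP[_] := integrable_funeneg measurableT ih.
  by under eq_integral => x _ do rewrite gee0_abs//.
have E x : (\int[k x]_y h (x, y) =
    \int[k x]_y h^\+ (x, y) - \int[k x]_y h^\- (x, y))%E.
  rewrite integralE; congr (_ - _)%E; apply: eq_integral => y _.
    by rewrite !funeposE.
  by rewrite !funenegE.
split.
  under eq_fun do rewrite E.
  exact: integrableB.
under [in RHS]eq_integral do rewrite E.
rewrite integralB//.
by rewrite [LHS]integralE !integral_joint//.
Qed.

End joint_theory.

Section disintegration.
Context {d1 d2} {T1 : measurableType d1} {T2 : measurableType d2} {R : realType}.
Variables (P : probability (T1 * T2)%type R) (k : T1 -> probability T2 R).
Hypothesis mk : forall B, measurable B -> measurable_fun [set: T1] (k ^~ B).
Hypothesis Pk : forall A B, measurable A -> measurable B ->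
  P (A `*` B) = (\int[P]_(z in fst @^-1` A) k z.1 B)%E.

(** Both measures agree on measurable rectangles, which are stable under intersection and generate
    the product sigma-algebra. *)
Lemma disintegration C : measurable C ->
  P C = joint (law measurable_fst P) mk C.
Proof.
move=> mC.
apply: (@measure_unique _ R _
  [set A `*` B | A in measurable & B in measurable] (fun=> setT)) => //.
- by rewrite measurable_prod_measurableType.
- move=> X Y [X1 mX1 [X2 mX2 <-{X}]] [Y1 mY1 [Y2 mY2 <-{Y}]].
  exists (X1 `&` Y1); first exact: measurableI.
  by exists (X2 `&` Y2); [exact: measurableI|rewrite setXI].
- by move=> _; exists setT => //; exists setT => //; rewrite setXTT.
- by rewrite bigcup_const//; exists 0%N.
- move=> _ [A mA [B mB <-]].
  transitivity (\int[law measurable_fst P]_(x in A) k x B)%E;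
    last exact/esym/joint_setX.
  rewrite [LHS]Pk// [RHS]integral_mkcond [LHS]integral_mkcond [RHS]integral_law.
  + by apply: eq_integral => z _; rewrite !patchE; congr (if _ then _ else _); rewrite !inE.
  + by apply/(measurable_restrictT _ mA); apply: measurable_funTS; exact: mk.
  + by move=> x; rewrite patchE; case: ifP.
- by move=> _; rewrite (le_lt_trans (probability_le1 _ _)) ?ltry.
Qed.

End disintegration.

(** * Topology of the covariate space and versions of the regression *)

Section tuple_topology.
Context {R : realType} {d : nat}.

(** Row vectors carry the sup norm; continuity of this map turns neighbourhoods in the product
    topology of tuples into sup-norm balls. *)
Let tuple_of_row (u : 'rV[R]_d) : d.-tuple R := [tuple u ord0 i | i < d].

Let tuple_of_row_continuous : continuous tuple_of_row.
Proof.
apply: (@continuous_comp_initial _ _ _ (@tuple_coords d R) tuple_of_row).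
move=> u.
have FF : Filter ((@tuple_coords d R \o tuple_of_row) x @[x --> u]).
  by apply: fmap_filter; exact: (nbhs_filter u).
apply/(@cvg_sup _ _ _ _ _ FF) => i.
apply: (@continuous_comp_initial (prod_topology (fun _ : 'I_d => R)) _ _
  (fun f => f i) (@tuple_coords d R \o tuple_of_row)) => v.
rewrite (_ : _ \o _ = fun w : 'rV[R]_d => w ord0 i); last first.
  by apply/funext => w /=; rewrite /tuple_coords tnth_mktuple.
exact: coord_continuous.
Qed.

Lemma nbhs_tuple (t : d.-tuple R) (U : set (d.-tuple R)) : nbhs t U ->
  exists2 e : R, 0 < e &
    forall s : d.-tuple R, (forall i, `|tnth t i - tnth s i| < e) -> U s.
Proof.
move=> tU; pose u : 'rV[R]_d := \row_i tnth t i.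
have rowK s : tuple_of_row (\row_i tnth s i) = s.
  by apply: eq_from_tnth => i; rewrite tnth_mktuple mxE.
have := @tuple_of_row_continuous u; rewrite /continuous_at /u rowK.
move=> /(_ _ tU)/nbhs_ballP[e /= e0 eU].
exists e => // s ts; rewrite -(rowK s); apply: eU; split=> // i j.
by rewrite !mxE; exact: ts.
Qed.

(** A countable family of measurable open cubes, with rational centres and radii 1/(N+1), used as a
    base of the topology. *)
Let box (q : rat * d.-tuple rat * nat) : set (R * d.-tuple R) :=
  [set v | `|ratr q.1.1 - v.1| < q.2.+1%:R^-1 /\
           forall i, `|ratr (tnth q.1.2 i) - tnth v.2 i| < q.2.+1%:R^-1].

Let measurable_box q : measurable (box q).
Proof.
have -> : box q = (fun v => `|ratr q.1.1 - v.1|) @^-1` `]-oo, q.2.+1%:R^-1[ `&`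
    \bigcap_(i in [set: 'I_d])
      (fun v => `|ratr (tnth q.1.2 i) - tnth v.2 i|) @^-1` `]-oo, q.2.+1%:R^-1[.
  apply/seteqP; split=> v /=; rewrite in_itv/=.
    by move=> [? h]; split=> // i _; rewrite /= in_itv/=.
  by move=> [? h]; split=> // i; have := h i I; rewrite /= in_itv/=.
apply: measurableI.
  rewrite -[X in measurable X]setTI.
  suff : measurable_fun [set: R * d.-tuple R]
      (fun v => `|ratr q.1.1 - v.1| : R) by apply => //; exact: measurable_itv.
  by apply: measurableT_comp => //; exact: measurable_funB.
apply: fin_bigcap_measurable => // i _; rewrite -[X in measurable X]setTI.
suff : measurable_fun [set: R * d.-tuple R]
    (fun v => `|ratr (tnth q.1.2 i) - tnth v.2 i| : R) by apply => //; exact: measurable_itv.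
apply: measurableT_comp => //; apply: measurable_funB => //.
by apply: (measurableT_comp (measurable_tnth i)).
Qed.

(** An open set is the union of the boxes it contains, and there are countably many of them. This
    links the open sets in the support condition to the product sigma-algebra. *)
Lemma open_tuple_measurable (U : set (R * d.-tuple R)) : open U -> measurable U.
Proof.
move=> oU.
have -> : U = \bigcup_(q in [set q | box q `<=` U]) box q.
  apply/seteqP; split=> [[x t] Uxt|v [q + qv]]; last exact.
  have : nbhs (x, t) U by apply: open_nbhs_nbhs.
  move=> [[A B] /= [/nbhs_ballP[e1 /= e10 e1A] /nbhs_tuple[e2 e20 e2B]] ABU].
  have [e e0 [ee1 ee2]] : exists2 e : R, 0 < e & e <= e1 /\ e <= e2.
    by exists (Num.min e1 e2); rewrite ?lt_min ?e10// !ge_min !lexx orbT.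
  (* The radius is below [e / 2], so a box of this radius containing [(x, t)] stays within distance
     [e] of it. *)
  have [n ne] : exists n : nat, n.+1%:R^-1 < e / 2.
    have [n _ /(_ n (leqnn n))] := near_infty_natSinv_lt (PosNum (divr_gt0 e0 (ltr0Sn R 1))).
    by exists n.
  have approx (y : R) : exists q : rat, `|ratr q - y| < n.+1%:R^-1.
    have /rat_in_itvoo[q] : y < y + n.+1%:R^-1 by rewrite ltrDl invr_gt0.
    rewrite in_itv/= => /andP[yq qy]; exists q.
    by rewrite ger0_norm ?subr_ge0 ?(ltW yq)// ltrBlDl.
  have [q0 q0x] := approx x.
  pose q i := xget 0 [set q : rat | `|ratr q - tnth t i| < n.+1%:R^-1].
  have qE i : `|ratr (q i) - tnth t i| < n.+1%:R^-1.
    exact: (xgetPex 0 (approx (tnth t i))).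
  exists (q0, [tuple q i | i < d], n) => /=; last first.
    by split=> //= i; rewrite tnth_mktuple.
  move=> [y s] [/= qy qs]; apply: ABU; split=> /=.
    apply: e1A; rewrite /ball/=.
    have := ler_distD (ratr q0) x y; rewrite (distrC x (ratr _)).
    move: q0x qy ne => /=; set N := _^-1; lra.
  apply: e2B => i; have := qs i; have := qE i; rewrite tnth_mktuple.
  have := ler_distD (ratr (q i)) (tnth t i) (tnth s i).
  rewrite (distrC (tnth t i) (ratr _)).
  move: ne; set N := _^-1; lra.
rewrite bigcup_mkcond; apply: countable_bigcupT_measurable => // q.
by case: ifPn.
Qed.

End tuple_topology.

Section law_theory.
Context {d1 d2} {T1 : measurableType d1} {T2 : measurableType d2} {R : realType}.
Variables (f : T1 -> T2) (mf : measurable_fun [set: T1] f) (P : probability T1 R).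

Lemma integral_law_in (D : set T2) (h : T2 -> \bar R) : measurable D ->
  measurable_fun D h ->
  (\int[law mf P]_(y in D) h y = \int[P]_(x in f @^-1` D) h (f x))%E.
Proof.
move=> mD mh; rewrite [LHS]integralE [RHS]integralE; congr (_ - _)%E.
  rewrite [LHS](ge0_integral_pushforward mf)//; last exact: measurable_funepos.
  by apply: eq_integral => x _; rewrite /= !funeposE.
rewrite [LHS](ge0_integral_pushforward mf)//; last exact: measurable_funeneg.
by apply: eq_integral => x _; rewrite /= !funenegE.
Qed.

(** Equal integrals over all measurable subsets of [D] force equality almost everywhere; boundedness
    makes [f1] integrable. Applied to two regression functions, this is uniqueness of versions. *)
Lemma ae_eq_law (D : set T2) (f1 f2 : T2 -> R) : measurable D ->
  measurable_fun D f1 -> measurable_fun D f2 ->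
  (exists M : R, forall y, D y -> `|f1 y| <= M) ->
  (forall A, measurable A -> A `<=` D ->
    (\int[P]_(x in f @^-1` A) (f1 (f x))%:E =
     \int[P]_(x in f @^-1` A) (f2 (f x))%:E)%E) ->
  {ae law mf P, forall y, D y -> f1 y = f2 y}.
Proof.
move=> mD mf1 mf2 [M f1M] H.
have : ae_eq (law mf P) D (EFin \o f1) (EFin \o f2).
  apply: integral_ae_eq => //.
  - apply: measurable_bounded_integrable => //.
      by rewrite (le_lt_trans (probability_le1 _ _)) ?ltry.
    exists M; split; first by rewrite num_real.
    by move=> x Mx y Dy; exact: le_trans (f1M _ Dy) (ltW Mx).
  - exact/measurable_EFinP.
  - move=> E ED mE; rewrite !integral_law_in//; first exact: H.
      by apply/measurable_EFinP; exact: measurable_funS mf2.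
    by apply/measurable_EFinP; exact: measurable_funS mf1.
by apply: filterS => y /= /[apply] -[].
Qed.

End law_theory.

(** Agreement at points arbitrarily close to [p] suffices: if the limits differed by [l], then
    [f1 - f2] would eventually be within [|l|] of [l], which fails where it vanishes. *)
Lemma lim_at_right_eq {R : realType} (f1 f2 : R -> R) (p : R) :
  cvg (f1 x @[x --> p^'+]) -> cvg (f2 x @[x --> p^'+]) ->
  (forall e, 0 < e -> exists x, [/\ p < x, x < p + e & f1 x = f2 x]) ->
  lim (f1 x @[x --> p^'+]) = lim (f2 x @[x --> p^'+]).
Proof.
move=> c1 c2 H; apply/eqP; rewrite -subr_eq0; apply: contraT => ne.
pose l := lim (f1 x @[x --> p^'+]) - lim (f2 x @[x --> p^'+]).
have : f1 x - f2 x @[x --> p^'+] --> l by exact: cvgB.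
have l0 : 0 < `|l| by rewrite normr_gt0.
move=> /cvgrPdist_lt/(_ _ l0)[e /= e0 he].
have [x [px xpe fx]] := H _ e0.
have := he x; rewrite fx subrr subr0 ltxx; apply => //=.
by rewrite ltr0_norm ?subr_lt0// opprB ltrBlDl.
Qed.

Section jump.
Context {R : realType} {d : nat}.
Variables (X : set R) (W : set (d.-tuple R)) (delta : R).
Hypotheses (delta0 : 0 < delta) (hX : `[0, delta[ `<=` X).
Variable g : R * d.-tuple R -> R.

Lemma measurable_ysection_fun (x : R) : measurable W -> measurable (X `*` W) ->
  measurable_fun (X `*` W) g -> X x -> measurable_fun W (fun w => g (x, w)).
Proof.
move=> mW mXW mg Xx.
apply: (measurable_comp mXW _ mg) => [_ [w Ww <-]//|].
exact: measurable_funTS.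
Qed.

(** The right limit is taken along one fixed sequence, so the jump is a pointwise limit of
    measurable functions of [w]. *)
Lemma measurable_jump_at_zero : measurable W -> measurable (X `*` W) ->
  measurable_fun (X `*` W) g ->
  (forall w, W w -> cvg (g (x, w) @[x --> 0^'+])) ->
  measurable_fun W (jump_at_zero g).
Proof.
move=> mW mXW mg cg.
have X0 : X 0 by apply: hX; rewrite /= in_itv/= lexx.
(* The denominator starts at 2, which keeps every [u k] strictly below [delta] and hence in [X]. *)
pose u (k : nat) := delta / k.+2%:R.
have u0 k : 0 < u k by rewrite divr_gt0.
have Xu k : X (u k).
  apply: hX; rewrite /= in_itv/= ltW//= ltr_pdivrMr// ltr_pMr//.
  by rewrite ltr1n.
apply: (@measurable_fun_cvg _ _ _ W (fun k w => g (0, w) - g (u k, w))).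
  by move=> k; apply: measurable_funB; exact: measurable_ysection_fun.
move=> w Ww; apply: cvgB; first exact: cvg_cst.
have /cvg_at_rightP := cg _ Ww; apply; split=> //.
rewrite (_ : 0 = delta * 0); last by rewrite mulr0.
apply: cvgMl_tmp; rewrite (_ : (fun _ => _) = (fun k : nat => [sequence k.+1%:R^-1]_k k.+1 : R))//.
rewrite (cvg_shiftS (fun k : nat => k.+1%:R^-1 : R)); exact: cvg_harmonic.
Qed.

End jump.

(** * Ingredients of the perturbation *)

Section shift_mixture.
Context {d} {T : measurableType d} {R : realType}.
Variables (k : T -> probability R R).
Hypothesis mk : forall B, measurable B -> measurable_fun [set: T] (k ^~ B).
Variables (a c0 c1 : T -> R).
Hypotheses (a_ge0 : forall v, 0 <= a v) (a_le1 : forall v, 0 <= 1 - a v).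
Hypotheses (ma : measurable_fun [set: T] a).
Hypotheses (mc0 : measurable_fun [set: T] c0) (mc1 : measurable_fun [set: T] c1).

Let measurable_shift (c : R) : measurable_fun [set: R] (fun y : R => y + c).
Proof. exact: measurable_funD. Qed.

(** Two shifts are provided: later [c0] recentres a replaced kernel, and [c1] adds the jump
    correction to it. *)
Definition shift_mixture (v : T) : probability R R :=
  mixture (a_ge0 v) (a_le1 v) (law (measurable_shift (c1 v)) (k v))
    (law (measurable_shift (c0 v)) (k v)).

Let measurable_shift_kernel (c : T -> R) B : measurable_fun [set: T] c ->
  measurable B ->
  measurable_fun [set: T] (fun v => k v ((fun y => y + c v) @^-1` B)).
Proof.
move=> mc mB.
have mC : measurable ((fun z : T * R => z.2 + c z.1) @^-1` B).
  rewrite -[X in measurable X]setTI.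
  suff : measurable_fun [set: T * R] (fun z => z.2 + c z.1) by apply.
  by apply: measurable_funD => //; exact: measurableT_comp.
have := measurable_kernel_xsection mk mC.
by under eq_fun do rewrite xsectionE.
Qed.

Lemma measurable_shift_mixture B : measurable B ->
  measurable_fun [set: T] (shift_mixture ^~ B).
Proof.
move=> mB; under eq_fun do rewrite mixtureE.
apply: emeasurable_funD; apply: emeasurable_funM.
- exact/measurable_EFinP.
- exact: measurable_shift_kernel.
- by apply/measurable_EFinP; exact: measurable_funB.
- exact: measurable_shift_kernel.
Qed.

Lemma integral_shift_mixture v (h : R -> \bar R) :
  measurable_fun [set: R] h -> (forall y, 0 <= h y)%E ->
  (\int[shift_mixture v]_y h y =
   (a v)%:E * \int[k v]_y h (y + c1 v)%R +
   (1 - a v)%:E * \int[k v]_y h (y + c0 v)%R)%E.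
Proof.
move=> mh h0; rewrite integral_mixture//.
by congr (_ * _ + _ * _)%E; exact: integral_law.
Qed.

Lemma shift_mixture_set1 v y : (forall x, k v [set x] = 0%E) ->
  shift_mixture v [set y] = 0%E.
Proof.
move=> k0; rewrite mixtureE.
have E c : law (measurable_shift c) (k v) [set y] = 0%E.
  rewrite -(k0 (y - c)); congr (k v _); apply/seteqP; split=> x /=.
    by move=> <-; rewrite addrK.
  by move=> ->; rewrite subrK.
by rewrite !E !mule0 adde0.
Qed.

Variables (v : T) (B m : R).
Hypotheses (kB : (\int[k v]_y `|y%:E| <= B%:E)%E)
  (km : (\int[k v]_y y%:E = m%:E)%E).

Let integrable_id : (k v).-integrable [set: R] (fun y => y%:E).
Proof.
apply/integrableP; split; first exact/measurable_EFinP.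
exact: le_lt_trans kB (ltry _).
Qed.

Let integrable_shift (c : R) :
  (k v).-integrable [set: R] (fun y => (y + c)%:E).
Proof.
under eq_fun do rewrite EFinD.
by apply: integrableD => //; exact: finite_measure_integrable_cst.
Qed.

Let integral_shift (c : R) : (\int[k v]_y (y + c)%:E = (m + c)%:E)%E.
Proof.
under eq_integral do rewrite EFinD.
rewrite integralD//; last exact: finite_measure_integrable_cst.
by rewrite km integral_cst//= probability_setT mule1.
Qed.

Lemma shift_mixture_abs_le :
  (\int[shift_mixture v]_y `|y%:E| <= (B + `|c0 v| + `|c1 v|)%:E)%E.
Proof.
have mabs : measurable_fun [set: R] (fun y : R => `|y%:E|%E).
  by apply: measurableT_comp => //; exact/measurable_EFinP.
have H c : (\int[k v]_y `|(y + c)%:E| <= (B + `|c|)%:E)%E.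
  apply: (@le_trans _ _ (\int[k v]_y (`|y%:E| + `|c|%:E))%E).
    apply: ge0_le_integral => //.
  by apply: measurableT_comp => //; apply/measurable_EFinP.
    - exact: emeasurable_funD.
    - by move=> y _; rewrite /= -EFinD lee_fin ler_normD.
  rewrite ge0_integralD// integral_cst//= probability_setT mule1 EFinD.
  by rewrite leeD2r.
rewrite integral_shift_mixture//.
have a0 := a_ge0 v; have a1 := a_le1 v.
have H1 := H (c1 v); have H0 := H (c0 v).
have B0 : 0 <= B.
  by rewrite -lee_fin (le_trans _ kB)// integral_ge0.
apply: (@le_trans _ _ ((a v)%:E * (B + `|c1 v|)%:E +
    (1 - a v)%:E * (B + `|c0 v|)%:E)%E).
  by apply: leeD; exact: lee_wpmul2l.
rewrite -!EFinM -EFinD lee_fin.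
have n1 := normr_ge0 (c1 v); have n0 := normr_ge0 (c0 v).
nra.
Qed.

Lemma integrable_shift_mixture :
  (shift_mixture v).-integrable [set: R] (fun y => y%:E).
Proof.
apply/integrableP; split; first exact/measurable_EFinP.
exact: le_lt_trans shift_mixture_abs_le (ltry _).
Qed.

Lemma shift_mixture_mean :
  (\int[shift_mixture v]_y y%:E = (m + a v * c1 v + (1 - a v) * c0 v)%:E)%E.
Proof.
have mid : measurable_fun [set: R] (@EFin R) by exact/measurable_EFinP.
rewrite integralE !integral_shift_mixture//; try exact: measurable_funepos;
  try exact: measurable_funeneg.
(* Integrability makes the positive and negative parts of each shifted integral real numbers, after
   which the mean formula is a linear identity. *)
have H c : exists p q : R, [/\
    (\int[k v]_y (@EFin R)^\+ (y + c)%R)%E = p%:E,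
    (\int[k v]_y (@EFin R)^\- (y + c)%R)%E = q%:E & p - q = m + c].
  have := integral_shift c; rewrite integralE.
  have := integrable_funepos measurableT (integrable_shift c).
  have := integrable_funeneg measurableT (integrable_shift c).
  move=> /integrable_fin_num => /(_ measurableT) fn.
  move=> /integrable_fin_num => /(_ measurableT) fp.
  rewrite -(fineK fn) -(fineK fp) => -[E].
  exists (fine (\int[k v]_y (fun y => (y + c)%:E)^\+ y)%E).
  exists (fine (\int[k v]_y (fun y => (y + c)%:E)^\- y)%E).
  split=> //; rewrite fineK//; apply: eq_integral => y _.
    by rewrite !funeposE.
  by rewrite !funenegE.
have [p1 [q1 [-> -> E1]]] := H (c1 v); have [p0 [q0 [-> -> E0]]] := H (c0 v).
rewrite -!EFinM -!EFinD; congr EFin.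
have -> : c1 v = p1 - q1 - m by rewrite E1; ring.
have -> : c0 v = p0 - q0 - m by rewrite E0; ring.
ring.
Qed.

End shift_mixture.

Section boundary_law.
Context {R : realType}.
Variable (e : R).
Hypothesis e0 : 0 < e.

Let half_ge0 : (0 : R) <= 2^-1. Proof. by rewrite invr_ge0. Qed.
Let half_le1 : (0 : R) <= 1 - 2^-1.
Proof. by rewrite subr_ge0 invf_le1// ler1n. Qed.

(** The uniform law lives on [measurableTypeR R]; its image under the identity is a law on [R]. *)
Let idR : measurableTypeR R -> R := idfun.

Let measurable_idR : measurable_fun setT idR.
Proof. exact: (@measurable_id _ (measurableTypeR R) setT). Qed.

Definition boundary_law : probability R R :=
  mixture half_ge0 half_le1 [the probability _ _ of dirac (0 : R)]
    (law measurable_idR [the probability _ _ of uniform_prob e0]).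

Let lawE A : law measurable_idR [the probability _ _ of uniform_prob e0] A =
  uniform_prob e0 A.
Proof. by []. Qed.

Lemma boundary_law_set1 x : x != 0 -> boundary_law [set x] = 0%E.
Proof.
move=> x0; rewrite mixtureE lawE/= diracE memNset; last by move=> /esym/eqP; exact/negP.
have -> : uniform_prob e0 [set x] = 0%E.
  have /null_content_dominatesP := dominates_uniform_prob e0; apply => //.
  exact: lebesgue_measure_set1.
by rewrite !mule0 adde0.
Qed.

Lemma boundary_law_itv : boundary_law `[0, e]%classic = 1%E.
Proof.
rewrite mixtureE lawE/= diracE mem_set/=; last by rewrite in_itv/= lexx ltW.
have -> : uniform_prob e0 `[0, e]%classic = 1%E.
  by rewrite /uniform_prob integral_uniform_pdf1.
by rewrite !mule1 -EFinD addrC subrK.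
Qed.

(** Both components have weight 1/2, so [N] is null for each. The atom gives the first claim; if [N]
    contained []0, r[], it would contain the interval up to [min r e], which has positive uniform
    mass. *)
Lemma boundary_law_null (N : set R) : measurable N -> boundary_law N = 0%E ->
  ~ N 0 /\ forall r, 0 < r -> exists x, [/\ 0 < x, x < r & ~ N x].
Proof.
move=> mN; rewrite mixtureE lawE => /eqP.
rewrite padde_eq0 ?mule_ge0 ?lee_fin// => /andP[].
rewrite !mule_eq0 !eqe subr_eq0 [1 == _]eq_sym !invr_eq1 !invr_eq0 !pnatr_eq1.
rewrite pnatr_eq0/= => /eqP d0 /eqP u0; split.
  by move=> N0; move: d0; rewrite indicE mem_set// => /eqP; rewrite oner_eq0.
move=> r r0; apply: contrapT => H.
pose c := Num.min r e.
have c0 : 0 < c by rewrite lt_min r0.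
have cN : `]0, c[ `<=` N.
  move=> x /=; rewrite in_itv/= => /andP[x0]; rewrite lt_min => /andP[xr xe].
  by apply: contrapT => Nx; apply: H; exists x.
have : uniform_prob e0 `]0, c[%classic = 0%E.
  apply/eqP; rewrite eq_le measure_ge0 andbT -[leRHS]u0.
  by rewrite le_measure ?inE//.
rewrite /uniform_prob integral_uniform_pdf.
have -> : `]0%R, c[ `&` `[0%R, e] = `]0%R, c[%classic.
  apply/setIidPl => x /=; rewrite !in_itv/= => /andP[x0].
  by rewrite lt_min => /andP[_ /ltW ->]; rewrite ltW.
rewrite (eq_integral (cst (e^-1)%:E)); last first.
  move=> x; rewrite inE/= in_itv/= => /andP[x0].
  rewrite lt_min => /andP[_ xe]; rewrite /uniform_pdf.
  by rewrite (ltW x0) (ltW xe) subr0.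
rewrite integral_cst//= lebesgue_measure_itv/= lte_fin c0 -EFinB subr0 -EFinM.
by move=> /eqP; rewrite eqe mulf_eq0 invr_eq0 (gt_eqF e0) (gt_eqF c0).
Qed.

End boundary_law.

Section conditional_mean.
Context {d} {T : measurableType d} {R : realType}.
Variables (Q : probability (T * R)%type R) (k : T -> probability R R).
Hypothesis mk : forall B, measurable B -> measurable_fun [set: T] (k ^~ B).
Hypothesis Qk : forall C, measurable C -> Q C = joint (law measurable_fst Q) mk C.
Hypothesis iQ : Q.-integrable setT (fun z => z.2%:E).

Let mu := law measurable_fst Q.

Definition abs_moment (v : T) : \bar R := (\int[k v]_y `|y%:E|)%E.

(** Taking [fine] of both parts gives a real, measurable function of every [v]; it is the mean of
    [k v] wherever the absolute moment is finite. *)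
Definition cond_mean (v : T) : R :=
  fine (\int[k v]_y ((@EFin R)^\+ y))%E - fine (\int[k v]_y ((@EFin R)^\- y))%E.

Let integralQ (h : T * R -> \bar R) : (\int[Q]_z h z = \int[joint mu mk]_z h z)%E.
Proof. by apply: eq_measure_integral => A mA _; exact: Qk. Qed.

Let integrableQ (h : T * R -> \bar R) :
  Q.-integrable setT h -> (joint mu mk).-integrable setT h.
Proof.
move=> /integrableP[mh hoo]; apply/integrableP; split=> //.
by rewrite -integralQ.
Qed.

Lemma measurable_abs_moment : measurable_fun [set: T] abs_moment.
Proof.
apply: (measurable_integral_kernel mk (h := fun z => `|z.2%:E|%E)) => //.
by apply: measurableT_comp => //; exact/measurable_EFinP.
Qed.

Lemma measurable_cond_mean : measurable_fun [set: T] cond_mean.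
Proof.
have mid : measurable_fun [set: R] (@EFin R) by exact/measurable_EFinP.
apply: measurable_funB; apply: (measurableT_comp (fine_measurable measurableT)).
  apply: (measurable_integral_kernel mk (h := fun z => (@EFin R)^\+ z.2)%E) => //.
  by apply: measurableT_comp => //; exact: measurable_funepos.
apply: (measurable_integral_kernel mk (h := fun z => (@EFin R)^\- z.2)%E) => //.
by apply: measurableT_comp => //; exact: measurable_funeneg.
Qed.

Let integrable_kernel v : (abs_moment v < +oo)%E ->
  (k v).-integrable [set: R] (@EFin R).
Proof. by move=> kv; apply/integrableP; split=> //; exact/measurable_EFinP. Qed.

Lemma cond_meanE v : (abs_moment v < +oo)%E ->
  (\int[k v]_y y%:E = (cond_mean v)%:E)%E.
Proof.
move=> /integrable_kernel iv.
rewrite integralE /cond_mean EFinB !fineK//.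
  exact: (integrable_fin_num measurableT (integrable_funeneg measurableT iv)).
exact: (integrable_fin_num measurableT (integrable_funepos measurableT iv)).
Qed.

(** Markov's inequality, with [I] the first absolute moment of Y under [Q]. *)
Lemma abs_moment_tail : exists I : R, 0 <= I /\ forall B : R, 0 < B ->
  (B%:E * mu [set v | B%:E <= abs_moment v] <= I%:E)%E.
Proof.
have Ifin : (\int[mu]_v abs_moment v < +oo)%E.
  rewrite /abs_moment -(integral_joint mu mk (h := fun z => `|z.2%:E|%E))//; last first.
    by apply: measurableT_comp => //; exact/measurable_EFinP.
  by have /integrableP[_] := integrableQ iQ.
have M0 v : (0 <= abs_moment v)%E by exact: integral_ge0.
have I0 : (0 <= \int[mu]_v abs_moment v)%E by exact: integral_ge0.
exists (fine (\int[mu]_v abs_moment v)%E); split; first exact: fine_ge0.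
move=> B B0; rewrite fineK ?ge0_fin_numE//.
have := le_integral_abse mu measurableT measurable_abs_moment B0.
rewrite setTI; under eq_integral => v _ do rewrite gee0_abs//.
congr (_ * mu _ <= _)%E; apply/seteqP; split=> v /=; by rewrite gee0_abs.
Qed.

(** The indicator of [A] is moved into the integrand, so that every section is integrable for its
    kernel: bounded moment on [A], zero elsewhere. *)
Lemma integral_cond_mean (A : set T) (B : R) : measurable A ->
  (forall v, A v -> (abs_moment v < B%:E)%E) ->
  (\int[Q]_(z in fst @^-1` A) z.2%:E =
   \int[Q]_(z in fst @^-1` A) (cond_mean z.1)%:E)%E.
Proof.
move=> mA AB.
rewrite -(integral_law_in measurable_fst Q (h := fun v => (cond_mean v)%:E))//;
  last by apply/measurable_EFinP; exact: measurable_funTS measurable_cond_mean.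
pose h (z : T * R) : \bar R := (z.2 * \1_A z.1)%:E.
have -> : (\int[Q]_(z in fst @^-1` A) z.2%:E = \int[Q]_z h z)%E.
  rewrite integral_mkcond; apply: eq_integral => z _; rewrite patchE /h indicE.
  have -> : (z \in fst @^-1` A) = (z.1 \in A) by apply/idP/idP; rewrite !inE.
  by case: ifP => _; rewrite ?mulr1 ?mulr0.
have ih : Q.-integrable setT h.
  apply: le_integrable iQ => //.
    apply/measurable_EFinP; apply: measurable_funM => //.
    by apply: measurableT_comp => //; exact: measurable_indic.
  move=> z _; rewrite /h lee_fin normrM indicE.
  by case: (z.1 \in A); rewrite ?normr1 ?normr0 ?mulr1 ?mulr0.
have ihk v : (k v).-integrable [set: R] (fun y => h (v, y)).
  rewrite /h/=; case: (pselect (A v)) => Av.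
    under eq_fun do rewrite indicE mem_set// mulr1.
    by apply: integrable_kernel; rewrite (lt_trans (AB _ Av))// ltry.
  under eq_fun do rewrite indicE memNset// mulr0.
  exact: integrable0.
have [_] := integral_joint_integrable (integrableQ ih) ihk.
rewrite -integralQ => ->; rewrite [RHS]integral_mkcond.
apply: eq_integral => v _; rewrite patchE /h/= indicE; case: ifPn => vA.
  under eq_integral do rewrite mulr1.
  by rewrite cond_meanE// (lt_trans (AB _ (set_mem vA)))// ltry.
under eq_integral do rewrite mulr0.
by rewrite integral0.
Qed.

End conditional_mean.

Lemma measure_setC_ae {d} {T : measurableType d} {R : realType}
    (mu : probability T R) (E F : set T) : measurable E -> measurable F ->
  {ae mu, forall v, F v -> E v} -> (mu (~` E) <= mu (~` F))%E.
Proof.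
move=> mE mF H.
have mEF : measurable (F `&` ~` E) by apply: measurableI => //; exact: measurableC.
have EF0 : mu (F `&` ~` E) = 0%E.
  apply: measure_negligible => //; apply: negligibleS H => v [Fv nEv] /=.
  by move=> h; exact: nEv (h Fv).
rewrite -[leRHS]adde0 -EF0.
apply: le_trans (measureU2 _ _ _) => //; last exact: measurableC.
apply: le_measure; rewrite ?inE//.
- exact: measurableC.
- by apply: measurableU => //; exact: measurableC.
by move=> v nEv; have [Fv|nFv] := pselect (F v); [right|left].
Qed.

Section good_set.
Context {R : realType} {d : nat}.
Local Notation obs := (R * d.-tuple R * R)%type.
Variables (X : set R) (W : set (d.-tuple R)) (Q : probability obs R).

(** The exceptional set [N] of full observations must become an exceptional set of covariates. For
    almost every [v] its section is null for [k v]. *)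
Lemma continuous_conditional_disintegration : continuous_conditional Q ->
  exists (k : R * d.-tuple R -> probability R R)
    (mk : forall B, measurable B -> measurable_fun setT (k ^~ B)),
    (forall C, measurable C -> Q C = joint (law measurable_fst Q) mk C) /\
    {ae law measurable_fst Q, forall v, forall y, k v [set y] = 0%E}.
Proof.
move=> [k0 [k0Q [N [mN N0 kN]]]].
pose k v : probability R R := as_probability (prob_kernel (s := k0) v).
have mk B : measurable B -> measurable_fun setT (k ^~ B).
  by move=> mB; exact: measurable_kernel.
have Qk : forall C, measurable C -> Q C = joint (law measurable_fst Q) mk C.
  by apply: disintegration => A B mA mB; rewrite k0Q.
exists k, mk; split=> //.
have mkN := measurable_kernel_xsection mk mN.
have : ae_eq (law measurable_fst Q) setT (fun v => k v (xsection N v)) (cst 0%E).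
  apply/ae_eq_integral_abs => //.
  under eq_integral do rewrite gee0_abs//.
  by rewrite -(jointE _ mk)// -Qk.
apply: filterS => v /= /(_ I) kv0 y.
(* A null section is not the whole line. One [y0] outside it suffices, since the absence of atoms of
   [k v] does not depend on [y0]. *)
have [y0 Ny0] : exists y0, ~ N (v, y0).
  apply: contrapT => H; have : k v setT = 0%E.
    rewrite -kv0; congr (k v _); apply/seteqP; split=> // y0 _.
    by rewrite /xsection/= inE; apply: contrapT => Ny; apply: H; exists y0.
  by rewrite probability_setT => /eqP; rewrite onee_eq0.
by apply: contrapT => ky; apply: Ny0; apply: kN => /= /(_ y); exact: ky.
Qed.

(** Absence of atoms and the mean identity hold almost surely where the moment is below [B]; only
    the moment bound costs probability, controlled by Markov's inequality. *)
Lemma exists_good_set (g : R * d.-tuple R -> R) (e : R) : 0 < e ->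
  measurable (X `*` W) -> Q (fst @^-1` (X `*` W)) = 1%E ->
  continuous_conditional Q -> version X W Q g ->
  exists (k : R * d.-tuple R -> probability R R)
    (mk : forall B, measurable B -> measurable_fun setT (k ^~ B))
    (E : set (R * d.-tuple R)) (B : R),
    [/\ forall C, measurable C -> Q C = joint (law measurable_fst Q) mk C,
        measurable E, E `<=` X `*` W, (law measurable_fst Q (~` E) <= e%:E)%E &
        forall v, E v -> [/\ forall y, k v [set y] = 0%E,
          (\int[k v]_y `|y%:E| <= B%:E)%E & (\int[k v]_y y%:E = (g v)%:E)%E]].
Proof.
move=> e0 mS QS cQ [[[M gM] _ _] [iQ mg gQ]].
have [k [mk [Qk katom]]] := continuous_conditional_disintegration cQ.
pose mu := law measurable_fst Q.
have [I [I0 tail]] := abs_moment_tail Qk iQ.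
(* This gives [I <= e * B], and adding 1 keeps [B] positive when [I] is 0. *)
pose B := I / e + 1.
have B0 : 0 < B by rewrite ltr_pwDr// divr_ge0// ltW.
pose F := [set v | abs_moment k v < B%:E]%E.
have mF : measurable F.
  rewrite -[F]setTI; apply: emeasurable_fun_infty_o => //.
  exact: measurable_abs_moment.
pose D := (X `*` W) `&` F.
have mD : measurable D by exact: measurableI.
have meanD : {ae mu, forall v, D v -> g v = cond_mean k v}.
  apply: ae_eq_law => //.
  - by apply: measurable_funS mg => //; exact: subIsetl.
  - by apply: measurable_funTS; exact: measurable_cond_mean.
  - by exists M => v [Sv _]; exact: gM.
  - move=> A mA AD; rewrite -gQ//; last by move=> v /AD[].
    by apply: (integral_cond_mean Qk iQ (B := B)) => // v /AD[].
have [N [mN N0 kN]] := katom.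
pose G := D `&` (fun v => g v == cond_mean k v) @^-1` [set true].
have mG : measurable G.
  apply: measurable_fun_eqr => //.
    by apply: measurable_funS mg => //; exact: subIsetl.
  by apply: measurable_funTS; exact: measurable_cond_mean.
have mE : measurable (G `&` ~` N) by apply: measurableI => //; exact: measurableC.
exists k, mk, (G `&` ~` N), B; split=> //.
- by move=> v [[[]]].
- apply: (@le_trans _ _ (mu (~` F))).
    apply: measure_setC_ae => //.
    have S1 : {ae mu, forall v, (X `*` W) v}.
      exists (~` (X `*` W)); split; [exact: measurableC| |by []].
      by rewrite [LHS]probability_setC// /mu [law _ _ _]QS subee.
    have Nae : {ae mu, forall v, ~ N v} by exists N; split=> // v /= /contrapT.
    near=> v => Fv; split; last by near: v.
    have Sv : (X `*` W) v by near: v.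
    by split; [split|]; rewrite //= (near meanD v)// eqxx.
  have -> : ~` F = [set v | (B%:E <= abs_moment k v)%E].
    by apply/seteqP; split=> v /=; rewrite leNgt => /negP.
  have eB : 0 < e * B by rewrite mulr_gt0.
  rewrite -(@lee_pmul2l _ B%:E)// (le_trans (tail _ B0))// -EFinM lee_fin.
  by rewrite /B mulrDl mul1r divfK ?gt_eqF// lerDl ltW.
- move=> v [[[Sv Fv] /eqP gv] Nv]; split.
  + by apply: contrapT => H; apply: Nv; exact: kN.
  + exact: ltW.
  + by rewrite cond_meanE ?gv// (lt_trans Fv)// ltry.
Unshelve. all: by end_near. Qed.

End good_set.

(** * Smooth functions and the exponential cutoff *)

Section smooth.
Context {R : realType}.
Implicit Types (S : set R) (f : R -> R).

Lemma smooth_onD S f1 f2 : smooth_on S f1 -> smooth_on S f2 ->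
  smooth_on S (fun x => f1 x + f2 x).
Proof.
move=> [D1 [D10 D1S]] [D2 [D20 D2S]]; exists (fun k x => D1 k x + D2 k x).
split=> [x Sx|k x Sx]; first by rewrite D10// D20.
apply: cvg_trans (cvgD (D1S k x Sx) (D2S k x Sx)); apply: near_eq_cvg.
by apply: nearW => y /=; rewrite -mulrDl addrACA opprD.
Qed.

Lemma eq_smooth_on S f1 f2 : (forall x, S x -> f1 x = f2 x) ->
  smooth_on S f1 -> smooth_on S f2.
Proof.
by move=> f12 [D [D0 DS]]; exists D; split=> // x Sx; rewrite D0// f12.
Qed.

Lemma cvg_difference_quotient f (x l : R) : is_derive x 1 f l ->
  (f y - f x) / (y - x) @[y --> x^'] --> l.
Proof.
move=> [df fl]; have : h^-1 *: (f (h *: 1 + x) - f x) @[h --> 0^'] --> l.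
  by rewrite -fl; exact: df.
move=> /cvgrPdist_lt H; apply/cvgrPdist_lt => e /H[r /= r0 hr].
exists r => //= y xy yx; have := hr (y - x); rewrite /= sub0r normrN.
rewrite -[(y - x) *: 1]/(_ * 1) mulr1 subrK [_ *: _]mulrC; apply.
  by rewrite distrC.
by rewrite subr_eq0.
Qed.

Variable n : nat.

(** Zero at 0 with right limit 1: a multiple of it changes the right limit of a regression function
    but not its value at 0. Larger [n] concentrates it near 0. *)
Definition decay (x : R) : R := if 0 < x then expR (- (n%:R * x)) else 0.

Lemma decay_ge0 x : 0 <= decay x.
Proof. by rewrite /decay; case: ifP => // _; exact: expR_ge0. Qed.

Lemma decay_le1 x : decay x <= 1.
Proof.
rewrite /decay; case: ifP => // x0; rewrite -expR0 ler_expR oppr_le0.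
by rewrite mulr_ge0// ltW.
Qed.

Lemma decay0 : decay 0 = 0. Proof. by rewrite /decay ltxx. Qed.

Lemma measurable_decay : measurable_fun [set: R] decay.
Proof.
rewrite /decay; apply: measurable_fun_ifT => //=; first exact: measurable_fun_ltr.
apply: (measurableT_comp (@measurable_expR R)).
by apply: measurableT_comp => //; exact: measurable_funM.
Qed.

Lemma decay_cvg : decay x @[x --> 0^'+] --> (1 : R).
Proof.
apply: (@cvg_trans _ (expR (- (n%:R * x)) @[x --> (0 : R)^'+])).
  apply: near_eq_cvg; near=> x; rewrite /decay ifT//.
apply: cvg_at_right_filter; rewrite -[X in _ --> X]expR0.
apply: continuous_cvg; first exact: continuous_expR.
rewrite -[X in _ --> X]oppr0; apply: cvgN.
rewrite -[X in _ --> X](mulr0 n%:R); apply: cvgMl_tmp; exact: cvg_id.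
Unshelve. all: by end_near. Qed.

(** With 0 excluded, each point has a neighbourhood on one side of 0, where the function is either
    an exponential with derivatives [F j] or identically zero. *)
Lemma smooth_on_decay S (c : R) : ~ S 0 -> smooth_on S (fun x => decay x * c).
Proof.
move=> S0; pose F j (x : R) := (- n%:R) ^+ j * expR (- (n%:R * x)) * c.
exists (fun j x => if 0 < x then F j x else 0); split=> [x _|j x Sx].
  by rewrite /decay /F expr0 mul1r; case: ifP; rewrite ?mul0r.
have x0 : x != 0 by apply/eqP => x0; apply: S0; rewrite -x0.
apply: cvg_within_filter.
have [xp|xn|/esym/eqP] := ltgtP 0 x; last by rewrite (negbTE x0).
- have dF : is_derive x 1 (F j) (F j.+1 x).
    have d1 : is_derive x 1 (fun y : R => - (n%:R * y)) (- n%:R).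
      have := is_deriveN (is_deriveZ n%:R (is_derive_id x (1 : R))).
      by rewrite /GRing.scale/= mulr1.
    have d2 : is_derive x 1 (fun y : R => expR (- (n%:R * y)))
        (expR (- (n%:R * x)) * - n%:R).
      exact: (is_derive1_comp (f := expR)).
    have := is_deriveZ ((- n%:R) ^+ j * c) d2; congr (is_derive _ _ _ _).
      by apply/funext => y; rewrite /F /GRing.scale/= mulrAC.
    by rewrite /F /GRing.scale/= exprS; ring.
  apply: cvg_trans (cvg_difference_quotient dF); apply: near_eq_cvg.
  by near=> y; rewrite ifT//; near: y; apply: nbhs_dnbhs; exact: lt_nbhsr.
- have c0 : (fun=> (0 : R)) y @[y --> x^'] --> (0 : R) by exact: cvg_cst.
  apply: cvg_trans c0; apply: near_eq_cvg.
  near=> y; rewrite ifF ?subrr ?mul0r//; apply/negbTE; rewrite -leNgt ltW//; near: y.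
  by apply: nbhs_dnbhs; exact: lt_nbhsl.
Unshelve. all: by end_near. Qed.

End smooth.

(** * The perturbed model *)

Section construction.
Context {R : realType} {d : nat}.
Local Notation V := (R * d.-tuple R)%type.
Variables (Q : probability (V * R)%type R) (k : V -> probability R R).
Hypothesis mk : forall B, measurable B -> measurable_fun [set: V] (k ^~ B).
Hypothesis Qk : forall C, measurable C -> Q C = joint (law measurable_fst Q) mk C.

Variables (g : V -> R) (M : R).
Hypotheses (mg : measurable_fun [set: V] g) (gM : forall v, `|g v| <= M).
Variables (s : d.-tuple R -> R) (Ms : R).
Hypotheses (ms : measurable_fun [set: d.-tuple R] s) (sM : forall w, `|s w| <= Ms).
Variables (E : set V) (B : R) (v0 : V).
Hypotheses (mE : measurable E) (Ev0 : E v0).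
Hypotheses (katom : forall v, E v -> forall y, k v [set y] = 0%E)
  (kB : forall v, E v -> (\int[k v]_y `|y%:E| <= B%:E)%E)
  (kmean : forall v, E v -> (\int[k v]_y y%:E = (g v)%:E)%E).
Variables (n : nat) (t : R) (t_ge0 : 0 <= t) (t_le1 : 0 <= 1 - t).
Variables (e : R) (e_gt0 : 0 < e).

Let Q1 : probability V R := law measurable_fst Q.
Let QW : probability (d.-tuple R) R := law measurable_snd Q1.
(** Points outside [E] are sent to the default [v0] in [E], so [k] composed with [r] has the good
    properties at every point. *)
Let r (v : V) : V := if v \in E then v else v0.

Let r_in v : E (r v).
Proof. by rewrite /r; case: ifPn => // /set_mem. Qed.

Let r_id v : E v -> r v = v.
Proof. by move=> Ev; rewrite /r mem_set. Qed.

Let mr : measurable_fun [set: V] r.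
Proof.
apply: measurable_fun_ifT => //; apply: (measurable_fun_bool true) => //.
rewrite setTI (_ : _ @^-1` _ = E)//.
by apply/seteqP; split=> v /=; [move/set_mem|move/mem_set].
Qed.

Let kr v : probability R R := k (r v).

Let mkr B' : measurable B' -> measurable_fun [set: V] (kr ^~ B').
Proof. by move=> mB; apply: (measurableT_comp (mk mB) mr). Qed.

Let a (v : V) : R := decay n v.1.
Let a_ge0 v : 0 <= a v. Proof. exact: decay_ge0. Qed.
Let a_le1 v : 0 <= 1 - a v. Proof. by rewrite subr_ge0; exact: decay_le1. Qed.
Let ma : measurable_fun [set: V] a.
Proof. exact: measurableT_comp (measurable_decay n) _. Qed.

(** Restores the mean [g v], since the replaced kernel has mean [g (r v)]; it vanishes on [E]. *)
Let c0 (v : V) : R := g v - g (r v).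
Let c1 (v : V) : R := c0 v + s v.2.
Let mc0 : measurable_fun [set: V] c0.
Proof. by apply: measurable_funB => //; exact: measurableT_comp mg mr. Qed.
Let mc1 : measurable_fun [set: V] c1.
Proof. by apply: measurable_funD => //; exact: measurableT_comp ms _. Qed.

Let K : V -> probability R R := shift_mixture kr c0 c1 a_ge0 a_le1.

Let mK B' : measurable B' -> measurable_fun [set: V] (K ^~ B').
Proof. exact: measurable_shift_mixture. Qed.

Definition perturbed_regression (v : V) : R := g v + decay n v.1 * s v.2.

Definition perturbed_covariates : probability V R :=
  mixture t_ge0 t_le1 [the probability _ _ of (boundary_law e_gt0 \x QW)%E] Q1.

Definition perturbed_model : probability (V * R)%type R :=
  joint perturbed_covariates mK.

Let krB v : (\int[kr v]_y `|y%:E| <= B%:E)%E. Proof. exact: kB. Qed.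
Let krmean v : (\int[kr v]_y y%:E = (g (r v))%:E)%E. Proof. exact: kmean. Qed.

Let K_set1 v y : K v [set y] = 0%E.
Proof. by apply: shift_mixture_set1 => x; exact: katom. Qed.

Lemma measurable_perturbed_regression :
  measurable_fun [set: V] perturbed_regression.
Proof.
by apply: measurable_funD => //; apply: measurable_funM => //;
  exact: measurableT_comp ms _.
Qed.

Let K_mean v : (\int[K v]_y y%:E = (perturbed_regression v)%:E)%E.
Proof.
rewrite (shift_mixture_mean c0 c1 a_ge0 a_le1 (krB v) (krmean v)).
by congr EFin; rewrite /perturbed_regression /c1 /c0 /a; ring.
Qed.

(** Here [c0] is bounded by 2M and [c1] by 2M + Ms. The bound is uniform in [v], so Y is integrable
    whatever the law of the covariates. *)
Let K_abs v : (\int[K v]_y `|y%:E| <= (B + M *+ 4 + Ms)%:E)%E.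
Proof.
apply: le_trans (shift_mixture_abs_le c0 c1 a_ge0 a_le1 (krB v)) _.
have c0M : `|c0 v| <= M + M.
  by rewrite (le_trans (ler_normB _ _))// lerD.
have c1M : `|c1 v| <= M + M + Ms.
  by rewrite (le_trans (ler_normD _ _))// lerD.
by rewrite lee_fin !mulrS mulr0n; lra.
Qed.

Let K_integrable v : (K v).-integrable [set: R] (fun y => y%:E).
Proof. exact: (integrable_shift_mixture c0 c1 a_ge0 a_le1 (krB v)). Qed.

Lemma perturbed_model_fst A : measurable A ->
  perturbed_model (fst @^-1` A) = perturbed_covariates A.
Proof. exact: joint_fst. Qed.

Lemma perturbed_model_continuous_conditional :
  continuous_conditional perturbed_model.
Proof.
exists (family_kernel mK); split.
  move=> A B' mA mB; rewrite /perturbed_model joint_setX//.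
  rewrite integral_mkcond [RHS]integral_mkcond.
  rewrite -(integral_joint_fst _ mK).
  - by apply: eq_integral => z _; rewrite !patchE; congr (if _ then _ else _);
      apply/idP/idP; rewrite !inE.
  - by apply/(measurable_restrictT _ mA); apply: measurable_funTS; exact: mK.
  - by move=> v; rewrite patchE; case: ifP.
by apply: aeW => z y; exact: K_set1.
Qed.

Lemma perturbed_model_integrable :
  perturbed_model.-integrable setT (fun z => z.2%:E).
Proof.
apply/integrableP; split; first exact/measurable_EFinP.
rewrite integral_joint//; last by apply: measurableT_comp => //; exact/measurable_EFinP.
apply: (@le_lt_trans _ _ (\int[perturbed_covariates]_v (B + M *+ 4 + Ms)%:E)%E).
  apply: ge0_le_integral => //.
  - by move=> v _; exact: integral_ge0.
  - apply: (measurable_integral_kernel mK (h := fun z => `|z.2%:E|%E)) => //.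
    by apply: measurableT_comp => //; exact/measurable_EFinP.
rewrite integral_cst// [X in (_ * X)%E](_ : _ = 1%E) ?mule1 ?ltry//.
exact: (probability_setT perturbed_covariates).
Qed.

Lemma perturbed_model_regression A : measurable A ->
  (\int[perturbed_model]_(z in fst @^-1` A) z.2%:E =
   \int[perturbed_model]_(z in fst @^-1` A) (perturbed_regression z.1)%:E)%E.
Proof.
move=> mA.
pose h (z : V * R) : \bar R := (z.2 * \1_A z.1)%:E.
have mh1 : measurable_fun [set: V] (fun v => perturbed_regression v * \1_A v).
  by apply: measurable_funM => //; exact: measurable_perturbed_regression.
have -> : (\int[perturbed_model]_(z in fst @^-1` A) z.2%:E =
    \int[perturbed_model]_z h z)%E.
  rewrite integral_mkcond; apply: eq_integral => z _; rewrite patchE /h indicE.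
  have -> : (z \in fst @^-1` A) = (z.1 \in A) by apply/idP/idP; rewrite !inE.
  by case: ifP => _; rewrite ?mulr1 ?mulr0.
have -> : (\int[perturbed_model]_(z in fst @^-1` A) (perturbed_regression z.1)%:E =
    \int[perturbed_model]_z (perturbed_regression z.1 * \1_A z.1)%:E)%E.
  rewrite integral_mkcond; apply: eq_integral => z _; rewrite patchE indicE.
  have -> : (z \in fst @^-1` A) = (z.1 \in A) by apply/idP/idP; rewrite !inE.
  by case: ifP => _; rewrite ?mulr1 ?mulr0.
have ih : perturbed_model.-integrable setT h.
  apply: le_integrable perturbed_model_integrable => //.
    apply/measurable_EFinP; apply: measurable_funM => //.
    by apply: measurableT_comp => //; exact: measurable_indic.
  move=> z _; rewrite /h lee_fin normrM indicE.
  by case: (z.1 \in A); rewrite ?normr1 ?normr0 ?mulr1 ?mulr0.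
have hE v y : h (v, y) = (y%:E * (\1_A v)%:E)%E by rewrite /h EFinM.
have ihk v : (K v).-integrable [set: R] (fun y => h (v, y)).
  under eq_fun do rewrite hE.
  by apply: integrableZr => //; exact: K_integrable.
have [_ ->] := integral_joint_integrable ih ihk.
have intK v : (\int[K v]_y h (v, y) = (perturbed_regression v * \1_A v)%:E)%E.
  under eq_integral do rewrite hE.
  rewrite (integralZr measurableT (K_integrable v)) K_mean EFinM//.
under eq_integral do rewrite intK.
have := integral_law_in measurable_fst perturbed_model measurableT
  (h := fun v => (perturbed_regression v * \1_A v)%:E).
rewrite preimage_setT => <-; last exact/measurable_EFinP.
by apply: eq_measure_integral => C mC _; exact/esym/perturbed_model_fst.
Qed.

(** The three errors are [t] for mixing the covariate law, [e1] for replacing the kernel outside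
    [E], and [e2] for the shift, made with probability [decay]. *)
Lemma perturbed_model_tv (e1 e2 : R) : (Q1 (~` E) <= e1%:E)%E ->
  (\int[Q1]_v (decay n v.1)%:E <= e2%:E)%E ->
  tv_le perturbed_model Q (t + e1 + e2).
Proof.
move=> QE Qa h mh h01.
have h0 z : (0 <= h z)%E by case/andP: (h01 z).
rewrite integral_joint//.
have -> : (\int[Q]_z h z = \int[joint Q1 mk]_z h z)%E.
  by apply: eq_measure_integral => A mA _; exact: Qk.
rewrite [in leRHS]integral_joint//.
pose F v := (\int[K v]_y h (v, y))%E.
pose G v := (\int[k v]_y h (v, y))%E.
have mhv v : measurable_fun [set: R] (fun y => h (v, y)).
  exact: measurable_fun_pair2.
have F01 v : (0 <= F v <= 1)%E by exact: integral_prob_le1.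
have G01 v : (0 <= G v <= 1)%E by exact: integral_prob_le1.
have F0 v : (0 <= F v)%E by case/andP: (F01 v).
have G0 v : (0 <= G v)%E by case/andP: (G01 v).
have mF : measurable_fun [set: V] F by exact: measurable_integral_kernel.
have mG : measurable_fun [set: V] G by exact: measurable_integral_kernel.
(* On [E] the kernel is [(1 - a) k v] plus a part of mass [a]; outside [E] the trivial bound 1 is
   absorbed by the indicator. *)
have FG v : (F v <= G v + ((\1_(~` E) v)%:E + (a v)%:E))%E.
  have [Ev|nEv] := pselect (E v); last first.
    rewrite indicE mem_set//= (@le_trans _ _ 1%E)//; first by case/andP: (F01 v).
    by rewrite addeA -[leLHS]adde0 leeD ?lee_fin// -[leLHS]add0e leeD.
  rewrite indicE memNset/=; last by apply.
  rewrite add0e /F integral_shift_mixture//.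
  rewrite addeC leeD//.
    rewrite /G /kr r_id//.
    under eq_integral do rewrite /c0 r_id// subrr addr0.
    rewrite -[leRHS]mul1e; apply: lee_wpmul2r; first exact: integral_ge0.
    by rewrite lee_fin gerBl a_ge0.
  rewrite -[leRHS]mule1; apply: lee_wpmul2l; first by rewrite lee_fin.
  suff /andP[] : (0 <= \int[kr v]_y h (v, y + c1 v)%R <= 1)%E by [].
  apply: integral_prob_le1 => //; apply: (measurableT_comp (mhv v)).
  exact: measurable_funD.
rewrite integral_mixture//.
have mind : measurable_fun [set: V] (fun v => (\1_(~` E) v)%:E : \bar R).
  by apply/measurable_EFinP; apply: measurable_indic; exact: measurableC.
have ma' : measurable_fun [set: V] (fun v => (a v)%:E).
  exact/measurable_EFinP.
have H1 : (\int[Q1]_v F v <= \int[Q1]_v G v + (e1 + e2)%:E)%E.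
  apply: (@le_trans _ _ (\int[Q1]_v (G v + ((\1_(~` E) v)%:E + (a v)%:E)))%E).
    apply: ge0_le_integral => //.
    by apply: emeasurable_funD => //; exact: emeasurable_funD.
  rewrite ge0_integralD//; last 2 first.
    by move=> v _; rewrite adde_ge0 ?lee_fin.
    exact: emeasurable_funD.
  rewrite leeD2l// ge0_integralD//; last by move=> v _; rewrite lee_fin.
  by rewrite EFinD leeD// integral_indic ?setIT//; exact: measurableC.
have /andP[_ H2] := integral_prob_le1 (boundary_law e_gt0 \x QW)%E mF F01.
move: (\int[Q1]_v \int[k v]_y h (v, y))%E H1 => IG H1.
rewrite -addrA (EFinD t) addeCA; apply: leeD.
  by rewrite -[leRHS]mule1; apply: lee_wpmul2l => //; rewrite lee_fin.
apply: le_trans H1.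
rewrite -[leRHS]mul1e; apply: lee_wpmul2r; first by apply: integral_ge0 => v _; exact: F0.
by rewrite lee_fin gerBl.
Qed.

End construction.

(** * Identification of the jump and approximation *)

Section decay_integral.
Context {d} {T : measurableType d} {R : realType}.

Lemma decay_cvg0 (x : R) : decay n x @[n --> \oo] --> (0 : R).
Proof.
rewrite /decay; case: ltP => x0; last exact: cvg_cst.
under eq_fun do rewrite -mulrN expRM_natl.
apply: cvg_expr; rewrite ger0_norm ?expR_ge0// -expR0 ltr_expR.
by rewrite oppr_lt0.
Qed.

(** Dominated convergence with the constant bound 1. *)
Lemma decay_integral_small (mu : probability T R) (f : T -> R) (e : R) :
  measurable_fun [set: T] f -> 0 < e ->
  exists n, (\int[mu]_v (decay n (f v))%:E <= e%:E)%E.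
Proof.
move=> mf e0.
have mdf n : measurable_fun [set: T] (fun v => (decay n (f v))%:E).
  by apply/measurable_EFinP; exact: measurableT_comp (measurable_decay n) mf.
have : (\int[mu]_v (decay n (f v))%:E)%E @[n --> \oo] --> (\int[mu]_v 0)%E.
  apply: (@dominated_cvg _ _ _ _ _ measurableT
    (fun n v => (decay n (f v))%:E) (cst 0%E) (cst 1%E)) => //.
  - by move=> v _; apply: cvg_EFin; [exact: nearW|exact: decay_cvg0].
  - exact: finite_measure_integrable_cst.
  - move=> n v _; rewrite /= lee_fin ger0_norm ?decay_ge0//; exact: decay_le1.
rewrite integral0 => /fine_cvgP[fin /cvgr0Pnorm_le/(_ _ e0) small].
have [n _ H] := @filterI _ \oo _ _ _ fin small.
have [nfin nsmall] := H n (leqnn n).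
exists n; rewrite -(fineK nfin) lee_fin; exact: le_trans (ler_norm _) nsmall.
Qed.

End decay_integral.

Section identification.
Context {R : realType} {d : nat}.
Local Notation V := (R * d.-tuple R)%type.
Variables (X : set R) (W : set (d.-tuple R)) (delta : R).
Hypotheses (delta0 : 0 < delta) (hX : `[0, delta[ `<=` X).
Hypotheses (mXW : measurable (X `*` W)) (mW : measurable W).
Variables (P : probability (V * R)%type R) (mu : probability V R).
Variables (t e : R) (t_gt0 : 0 < t) (t_ge0 : 0 <= t) (t_le1 : 0 <= 1 - t).
Variables (e_gt0 : 0 < e).

Let QW : probability (d.-tuple R) R := law measurable_snd mu.
Let nu := mixture t_ge0 t_le1
  [the probability _ _ of (boundary_law e_gt0 \x QW)%E] mu.
Hypothesis Pnu : forall A, measurable A -> P (fst @^-1` A) = nu A.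

(** Two versions agree off a null set [N]. As [t > 0], [N] is also null for the boundary component,
    so for almost every [w] its section is null for [boundary_law]: the versions agree at 0 and at
    points accumulating at 0 from the right, hence have equal jumps. *)
Lemma version_jump_ae (g1 g2 : V -> R) :
  version X W P g1 -> version X W P g2 ->
  {ae QW, forall w, W w -> jump_at_zero g1 w = jump_at_zero g2 w}.
Proof.
move=> [[[M1 g1M] _ c1] [_ mg1 rg1]] [[_ _ c2] [_ mg2 rg2]].
have [N [mN N0 gN]] : {ae law measurable_fst P, forall v, (X `*` W) v -> g1 v = g2 v}.
  apply: ae_eq_law => //; first by exists M1.
  by move=> A mA AXW; rewrite -rg1// -rg2.
have {}N0 : (boundary_law e_gt0 \x QW)%E N = 0%E.
  have : nu N = 0%E by rewrite -Pnu.
  rewrite mixtureE => /eqP; rewrite padde_eq0 ?mule_ge0 ?lee_fin//.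
  by rewrite mule_eq0 eqe gt_eqF//= => /andP[/eqP].
have mNy : measurable_fun setT (fun w => boundary_law e_gt0 (ysection N w)).
  exact: measurable_fun_ysection.
have : ae_eq QW setT (fun w => boundary_law e_gt0 (ysection N w)) (cst 0%E).
  apply/ae_eq_integral_abs => //.
  under eq_integral do rewrite gee0_abs//.
  (* The product in the other order of integration, in which the measure of [N] is the integral of
     its sections at fixed [w]. *)
  pose m' : {measure set V -> \bar R} := (boundary_law e_gt0 \x^ QW)%E.
  have m'E A A' : measurable A -> measurable A' ->
      m' (A `*` A') = (boundary_law e_gt0 A * QW A')%E.
    by move=> mA mA'; exact: product_measure2E.
  by rewrite -[RHS]N0; apply/esym; exact: (product_measure_unique m'E mN).
apply: filterS => w /= /(_ I) Nw Ww.
have [N00 Nr] := boundary_law_null (measurable_ysection w mN) Nw.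
have nN x : X x -> ~ ysection N w x -> g1 (x, w) = g2 (x, w).
  move=> Xx Nx; apply: contrapT => g12; apply: Nx.
  by rewrite /ysection/= inE; apply: gN => /= /(_ (conj Xx Ww)).
have X0 : X 0 by apply: hX; rewrite /= in_itv/= lexx.
rewrite /jump_at_zero nN//.
congr (_ - _); apply: (lim_at_right_eq (c1 _ Ww) (c2 _ Ww)).
move=> r r0; have rd0 : 0 < Num.min r delta by rewrite lt_min r0.
have [x [x0 xr Nx]] := Nr _ rd0.
move: xr; rewrite lt_min => /andP[xr xd].
exists x; split=> //; first by rewrite add0r.
by apply: nN => //; apply: hX; rewrite /= in_itv/= xd ltW.
Qed.

(** Mixing leaves the law of W unchanged, both components having marginal [QW]. *)
Lemma nu_snd (A : set (d.-tuple R)) : measurable A -> nu (snd @^-1` A) = QW A.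
Proof.
move=> mA; rewrite mixtureE.
have -> : [the probability _ _ of (boundary_law e_gt0 \x QW)%E] (snd @^-1` A) =
    QW A.
  have -> : snd @^-1` A = [set: R] `*` A :> set V.
    by apply/seteqP; split=> -[] //= ? ? [].
  rewrite [LHS]product_measure1E// [X in (X * _)%E](_ : _ = 1%E) ?mul1e//.
  exact: (probability_setT (boundary_law e_gt0)).
by rewrite -muleDl ?fin_num_measure// -EFinD addrC subrK mul1e.
Qed.

Lemma aggregate_discontinuity_identified (g1 g2 : V -> R) (m : R) : 0 <= m ->
  QW W = 1%E -> version X W P g1 -> version X W P g2 ->
  (forall w, W w -> jump_at_zero g2 w = - m) ->
  aggregate_discontinuity W g1 P = m.
Proof.
move=> m0 QW1 v1 v2 j2; have [N [mN N0 jN]] := version_jump_ae v1 v2.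
have [[_ _ c1] [_ mg1 _]] := v1.
have Psnd A : measurable A -> P [set z | A z.1.2] = QW A.
  move=> mA; rewrite -nu_snd//.
  have mA' : measurable (snd @^-1` A : set V).
    by rewrite -[X in measurable X]setTI; exact: measurable_snd.
  by rewrite -(Pnu mA').
have mD : measurable [set z : V * R | W z.1.2].
  rewrite (_ : [set z | _] = (snd \o fst) @^-1` W)// -[X in measurable X]setTI.
  by apply: (measurableT_comp measurable_snd measurable_fst).
rewrite /aggregate_discontinuity /Rintegral.
have mj : measurable_fun [set z : V * R | W z.1.2] (fun z => jump_at_zero g1 z.1.2).
  apply: (@measurable_comp _ _ _ _ _ _ W (jump_at_zero g1) _ (snd \o fst)) => //.
  - by move=> _ [z Wz <-].
  - exact: (measurable_jump_at_zero delta0 hX).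
  - apply: measurable_funTS; exact: (measurableT_comp measurable_snd measurable_fst).
rewrite (ae_eq_integral (cst (m ^+ 2)%:E))//.
- rewrite integral_cst// [X in (_ * X)%E](_ : _ = 1%E).
    by rewrite mule1/= sqrtr_sqr ger0_norm.
  by rewrite -QW1; exact: Psnd.
- by apply/measurable_EFinP; exact: measurable_funX.
- exists [set z | N z.1.2]; split.
  + rewrite (_ : [set z | _] = (snd \o fst) @^-1` N)// -[X in measurable X]setTI.
    by apply: (measurableT_comp measurable_snd measurable_fst).
  + by rewrite -N0; exact: Psnd.
  + move=> z /= H; apply: jN => /= Hw; apply: H => Wz.
    by rewrite Hw// j2// sqrrN.
Qed.

End identification.

Section regressions.
Context {R : realType} {d : nat}.
Local Notation V := (R * d.-tuple R)%type.
Variables (X : set R) (W : set (d.-tuple R)) (delta : R).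
Hypotheses (delta0 : 0 < delta) (hX : `[0, delta[ `<=` X).

Let near_X : \forall x \near (0 : R)^'+, X x.
Proof.
near=> x; apply: hX; rewrite /= in_itv/=; apply/andP; split; first exact/ltW.
by near: x; exact: nbhs_right_lt.
Unshelve. all: by end_near. Qed.

Lemma eq_regressions (g g' : V -> R) :
  (forall v, (X `*` W) v -> g v = g' v) -> regressions X W g -> regressions X W g'.
Proof.
move=> gg' [[M gM] sg cg].
have nearg w : W w -> \forall x \near (0 : R)^'+, g (x, w) = g' (x, w).
  by move=> Ww; apply: filterS near_X => x Xx; exact: gg'.
split; first by exists M => v Sv; rewrite -gg'//; exact: gM.
- move=> w Ww; apply: eq_smooth_on (sg _ Ww) => x [Xx _]; exact: gg'.
- move=> w Ww; apply/cvg_ex; exists (lim (g (x, w) @[x --> 0^'+])).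
  by apply: cvg_trans (cg _ Ww); apply: near_eq_cvg; exact: nearg.
Qed.

Variables (g : V -> R) (s : d.-tuple R -> R) (n : nat) (Ms : R).
Hypotheses (rg : regressions X W g) (sM : forall w, `|s w| <= Ms).

Let cvg_perturbed w : W w -> perturbed_regression g s n (x, w) @[x --> 0^'+] -->
  lim (g (x, w) @[x --> 0^'+]) + s w.
Proof.
move=> Ww; have [_ _ cg] := rg; apply: cvgD; first exact: cg.
rewrite -[X in _ --> X]mul1r; exact: (cvgMr_tmp (b := s w) (decay_cvg n)).
Qed.

Lemma regressions_perturbed : regressions X W (perturbed_regression g s n).
Proof.
have [[M gM] sg cg] := rg; split.
- exists (M + Ms) => v Sv; apply: le_trans (ler_normD _ _) _.
  apply: lerD; first exact: gM.
  rewrite normrM ger0_norm ?decay_ge0//.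
  apply: le_trans (sM v.2); rewrite -[leRHS]mul1r ler_wpM2r//; exact: decay_le1.
- move=> w Ww; apply: smooth_onD; first exact: sg.
  by apply: (@smooth_on_decay _ n _ (s w)) => -[_] /=; apply.
- by move=> w Ww; apply/cvg_ex; exists (lim (g (x, w) @[x --> 0^'+]) + s w); exact: cvg_perturbed.
Qed.

Lemma jump_perturbed w : W w ->
  jump_at_zero (perturbed_regression g s n) w = jump_at_zero g w - s w.
Proof.
move=> Ww; rewrite /jump_at_zero (cvg_lim _ (cvg_perturbed Ww))//.
by rewrite /perturbed_regression decay0 mul0r addr0 opprD addrA.
Qed.

Lemma jump_at_zero_bounded (M : R) w : W w ->
  (forall v, (X `*` W) v -> `|g v| <= M) -> `|jump_at_zero g w| <= M + M.
Proof.
move=> Ww gM; have [_ _ cg] := rg.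
rewrite (le_trans (ler_normB _ _))// lerD//.
  by apply: gM; split=> //; apply: hX; rewrite /= in_itv/= lexx.
have ng : \forall x \near (0 : R)^'+, `|g (x, w)| <= M.
  by apply: filterS near_X => x Xx; exact: gM.
rewrite ler_norml; apply/andP; split.
  by apply: limr_ge; [exact: cg|apply: filterS ng => x; rewrite ler_norml => /andP[]].
by apply: limr_le; [exact: cg|apply: filterS ng => x; rewrite ler_norml => /andP[]].
Qed.

End regressions.

Section approximation.
Context {R : realType} {d : nat}.
Local Notation V := (R * d.-tuple R)%type.
Variables (X : set R) (W : set (d.-tuple R)) (delta : R).
Hypotheses (delta0 : 0 < delta) (hX : `[0, delta[ `<=` X).

(** The conclusion covers all versions of the regression of [P], so it applies whichever version is
    selected for [P]. *)
Lemma null_approximation (Q : probability (V * R)%type R) (m e : R) :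
  models X W Q -> 0 <= m -> 0 < e ->
  exists P, [/\ models X W P, tv_le P Q e &
    forall g, version X W P g -> aggregate_discontinuity W g P = m].
Proof.
move=> [[mXW QXW Qopen] [Q0 Qx] cQ [g0 vg0]] m0 e0.
have X0 : X 0 by apply: hX; rewrite /= in_itv/= lexx.
have mW : measurable W.
  rewrite (_ : W = xsection (X `*` W) 0); first exact: measurable_xsection.
  by rewrite in_xsectionX// inE.
have [[[M g0M] _ _] [_ mg0 _]] := vg0.
(* Extension by zero makes the version bounded and measurable on the whole space. *)
pose g (v : V) : R := if v \in X `*` W then g0 v else 0.
have gg0 v : (X `*` W) v -> g0 v = g v by move=> Sv; rewrite /g mem_set.
have rg : regressions X W g by apply: (eq_regressions delta0 hX gg0); case: vg0.
have gM v : `|g v| <= `|M|.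
  rewrite /g; case: ifPn => [/set_mem/g0M|_]; last by rewrite normr0.
  by move=> /le_trans; apply; exact: ler_norm.
have mg : measurable_fun [set: V] g.
  rewrite (_ : g = g0 \_ (X `*` W)); first exact/(measurable_restrictT _ mXW).
  by apply/funext => v; rewrite patchE.
(* The perturbation lowers the jump by [s w], so the new jump is [- m] for every [w] in [W]. *)
pose s (w : d.-tuple R) : R := if w \in W then jump_at_zero g w + m else 0.
have ms : measurable_fun [set: d.-tuple R] s.
  rewrite (_ : s = (fun w => jump_at_zero g w + m) \_ W); last first.
    by apply/funext => w; rewrite patchE.
  apply/(measurable_restrictT _ mW); apply: measurable_funD => //.
  apply: (measurable_jump_at_zero delta0 hX) => //; last by case: rg.
  exact: measurable_funTS.
have sM w : `|s w| <= `|M| + `|M| + m.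
  rewrite /s; case: ifPn => [/set_mem Ww|_]; last first.
    by rewrite normr0 addr_ge0// addr_ge0.
  rewrite (le_trans (ler_normD _ _))// (ger0_norm m0) lerD2r.
  exact: (jump_at_zero_bounded delta0 hX rg).
(* One third of [e] for each error term; the cap 1/2 makes [E] nonempty and [1 - e1] positive. *)
pose e1 : R := Num.min (e / 3) 2^-1.
have e10 : 0 < e1.
  by rewrite lt_min divr_gt0 ?invr_gt0 ?ltr0n.
have e1e : e1 <= e / 3 by rewrite ge_min lexx.
have e1h : e1 <= 2^-1 by rewrite ge_min lexx orbT.
have [k [mk [E [B [Qk mE EXW QE Egood]]]]] :=
  exists_good_set e10 mXW QXW cQ vg0.
pose Q1 : probability V R := law measurable_fst Q.
have [v0 Ev0] : exists v0, E v0.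
  apply: contrapT => nE; have : Q1 (~` E) = 1%E.
    rewrite (_ : ~` E = setT) ?probability_setT//.
    by apply/seteqP; split=> // v _ Ev; apply: nE; exists v.
  move=> E1; move: QE; rewrite [law _ _ _]E1 lee_fin => h.
  have := le_trans h e1h; rewrite leNgt invf_lt1//; lra.
have [n Qn] := decay_integral_small Q1 (@measurable_fst _ _ _ _ : measurable_fun [set: V] fst) e10.
have t_le1 : 0 <= 1 - e1.
  by rewrite subr_ge0 (le_trans e1h)// invf_le1// ler1n.
(* The boundary law is placed on [[0, delta / 2]], which lies inside [X]. *)
have d20 : 0 < delta / 2 by rewrite divr_gt0.
have kgood v : E v -> (\int[k v]_y y%:E = (g v)%:E)%E.
  by move=> Ev; have [_ _ ->] := Egood v Ev; rewrite gg0//; exact: EXW.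
have kB v : E v -> (\int[k v]_y `|y%:E| <= B%:E)%E by move=> /Egood[].
have katom v : E v -> forall y, k v [set y] = 0%E by move=> /Egood[].
pose P := perturbed_model Q mk mg ms v0 mE n (ltW e10) t_le1 d20.
pose gP := perturbed_regression g s n.
have Pfst A : measurable A -> P (fst @^-1` A) =
    perturbed_covariates Q (ltW e10) t_le1 d20 A.
  exact: perturbed_model_fst.
have t_lt1 : 0 < 1 - e1 by rewrite subr_gt0 (le_lt_trans e1h)// invf_lt1// ltr1n.
(* At least the fraction [1 - e1] of the old covariate mass survives, so the support and the atom at
   0 persist. *)
have Ppos A : measurable A -> (0 < Q (fst @^-1` A))%E -> (0 < P (fst @^-1` A))%E.
  move=> mA A0; rewrite Pfst// mixtureE.
  apply: (@lt_le_trans _ _ ((1 - e1)%:E * Q1 A)%E).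
    by rewrite mule_gt0// lte_fin.
  by rewrite leeDr// mule_ge0// lee_fin ltW.
have mX0 x : measurable [set v : V | v.1 = x].
  rewrite (_ : [set v | _] = fst @^-1` [set x])//.
  by rewrite -[X in measurable X]setTI; exact: measurable_fst.
have QW1 : law measurable_snd Q1 W = 1%E.
  apply/eqP; rewrite eq_le probability_le1//= -QXW.
  apply: (@le_measure _ _ _ Q); rewrite ?inE.
  - by rewrite -[X in measurable X]setTI; exact: measurable_fst.
  - rewrite -[X in measurable X]setTI.
    by apply: (measurableT_comp measurable_snd measurable_fst).
  - by move=> z [].
have vgP : version X W P gP.
  have rgP : regressions X W gP by exact: (regressions_perturbed n rg sM).
  split=> //; split.
  - exact: (perturbed_model_integrable Q mk mg gM ms sM mE Ev0 kB).
  - by apply: measurable_funTS; exact: measurable_perturbed_regression.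
  - move=> A mA _.
    exact: (perturbed_model_regression Q mk mg gM ms sM mE Ev0 kB kgood).
have jgP w : W w -> jump_at_zero gP w = - m.
  by move=> Ww; rewrite (jump_perturbed s n rg Ww) /s mem_set// opprD addrA subrr add0r.
exists P; split.
- split.
  + split=> //.
    * rewrite [LHS]Pfst// mixtureE [X in (_ + _ * X)%E]QXW mule1.
      rewrite [X in (_ * X + _)%E](_ : _ = 1%E).
        by rewrite mule1 -EFinD addrC subrK.
      have [w0 Ww0] : exists w, W w by exists v0.2; have [] := EXW _ Ev0.
      have mX : measurable X.
        rewrite (_ : X = ysection (X `*` W) w0); first exact: measurable_ysection.
        by rewrite in_ysectionX// inE.
      rewrite [LHS]product_measure1E// [X in (_ * X)%E]QW1 mule1.
      apply/eqP; rewrite eq_le probability_le1//= -(boundary_law_itv d20).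
      apply: le_measure; rewrite ?inE//.
      move=> x; rewrite /= in_itv/= => /andP[x0 xd]; apply: hX.
      by rewrite /= in_itv/= x0 (le_lt_trans xd)// ltr_pdivrMr// ltr_pMr// ltr1n.
    * move=> U oU US; apply: Ppos; first exact: open_tuple_measurable.
      exact: Qopen.
  + split; first exact: (Ppos [set v | v.1 = 0]).
    move=> x x0; rewrite [LHS](Pfst [set v | v.1 = x])// mixtureE.
    rewrite [X in (_ + _ * X)%E](Qx _ x0) mule0 adde0.
    rewrite [X in (_ * X)%E](_ : _ = 0%E) ?mule0//.
    rewrite (_ : [set v | _] = [set x] `*` [set: d.-tuple R]); last first.
      by apply/seteqP; split=> -[] //= ? ? [].
    by rewrite [LHS]product_measure1E// [X in (X * _)%E](boundary_law_set1 d20 x0) mul0e.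
  + exact: perturbed_model_continuous_conditional.
  + by exists gP.
- have := perturbed_model_tv Qk mg ms v0 mE (ltW e10) t_le1 d20 QE Qn.
  move=> PQ h mh h01; apply: le_trans (PQ h mh h01) _.
  by rewrite leeD2l// lee_fin; lra.
- move=> g' vg'.
  exact: (aggregate_discontinuity_identified delta0 hX mXW mW e10 Pfst
    m0 QW1 vg' vgP jgP).
Qed.

End approximation.

(** * Sets of infinite length and the testing and coverage conclusions *)

Lemma set_length_unbounded {R : realType} (S : set R) :
  (forall n : nat, exists2 j : nat, (n <= j)%N & S j%:R) -> set_length S = +oo%E.
Proof.
move=> Sub.
have sup_oo : ereal_sup (EFin @` S) = +oo%E.
  apply/eqyP => r _.
  have [j rj Sj] := Sub (Num.truncn r).+1.
  apply: (@le_trans _ _ (j%:R)%:E).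
    by rewrite lee_fin (le_trans (ltW (truncnS_gt r)))// ler_nat.
  by apply: ereal_sup_ubound; exists j%:R.
have [j _ Sj] := Sub 0%N.
have inf_lt : (ereal_inf (EFin @` S) <= (j%:R)%:E)%E.
  by apply: ereal_inf_lbound; exists j%:R.
(* The infimum is at most a natural number, hence not [+oo], so subtracting it from [+oo] gives
   [+oo]. *)
rewrite /set_length sup_oo addye; first by rewrite maxey.
by rewrite eqe_oppLR /=; apply/eqP => h; rewrite h in inf_lt.
Qed.

(** The values are restricted to [0 <= m] because the aggregate discontinuity is a square root: a
    negative [m] has no null models. Nonemptiness of [models X W] enters the last claim because an
    infimum over the empty set is [+oo]. *)
Theorem corollary6 (R : realType) (d n : nat) (hn : (1 <= n)%N)
    (delta : R) (X : set R) (W : set (d.-tuple R))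
    (hdelta : 0 < delta) (hX : `[0, delta[ `<=` X)
    (g : probability (R * d.-tuple R * R)%type R -> R * d.-tuple R -> R)
    (hg : forall P, models X W P -> version X W P (g P)) :
  [/\ forall m : R, 0 <= m -> forall Q, alt_models X W g m Q ->
        exists u : nat -> probability (n.-tuple (R * d.-tuple R * R)) R,
          (forall k, convex_hull [set power_probability P n
                                 | P in null_models X W g m] (u k)) /\
          cvg_in_distribution u (power_probability Q n),
      forall m : R, 0 <= m ->
        forall phi : n.-tuple (R * d.-tuple R * R) -> R,
        is_test phi ->
        (forall Q, alt_models X W g m Q ->
           as_continuous (power_probability Q n) phi) ->
        (ereal_sup [set 'E_(power_probability Q n)[phi]
                   | Q in alt_models X W g m] <=
         ereal_sup [set 'E_(power_probability P n)[phi]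
                   | P in null_models X W g m])%E &
      models X W !=set0 ->
        forall C : n.-tuple (R * d.-tuple R * R) -> set R,
        is_confidence_set C ->
        (forall P, models X W P ->
           (power_probability P n).-integrable setT (set_length \o C)) ->
        ereal_inf [set power_probability P n
                         [set z | C z (aggregate_discontinuity W (g P) P)]
                  | P in models X W] = 0%E].
Proof.
have approx (m : R) Q (e : R) : 0 <= m -> models X W Q -> 0 < e ->
    exists P, null_models X W g m P /\
      tv_le (power_probability P n) (power_probability Q n) e.
  (* Accuracy [e / n] for one observation, since the n-fold power multiplies the error by [n]. *)
  move=> m0 mQ e0; have e'0 : 0 < e / n%:R by rewrite divr_gt0// ltr0n.
  have [P [mP PQ Pm]] := null_approximation hdelta hX mQ m0 e'0.
  exists P; split; first by split=> //; apply: Pm; exact: hg.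
  have := tv_le_power (ltW e'0) PQ (n := n).
  by rewrite -[_ *+ n]mulr_natr divfK// pnatr_eq0 -lt0n.
split.
- move=> m m0 Q [mQ _].
  have /choice[P HP] : forall k : nat, exists P, null_models X W g m P /\
      tv_le (power_probability P n) (power_probability Q n) k.+1%:R^-1.
    by move=> k; apply: approx => //; rewrite invr_gt0.
  exists (fun k => power_probability (P k) n); split.
    by move=> k; apply: convex_hull1; exists (P k) => //; have [] := HP k.
  apply: (tv_le_cvg_in_distribution (e := fun k : nat => k.+1%:R^-1)).
  + by move=> k; rewrite invr_ge0.
  + by move=> k; have [] := HP k.
  + exact: cvg_harmonic.
- move=> m m0 phi [mphi phi01] _; apply: ge_ereal_sup => _ [Q [mQ _] <-].
  apply/lee_addgt0Pr => e e0; have [P [nP PQ]] := approx m Q e m0 mQ e0.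
  apply: (@le_trans _ _ ('E_(power_probability P n)[phi] + e%:E)%E).
    rewrite unlock; apply: (tv_le_sym PQ); first exact/measurable_EFinP.
    by move=> z; rewrite !lee_fin.
  by rewrite leeD2r//; apply: ereal_sup_ubound; exists P.
- move=> [Q mQ] C mC iC; apply/eqP; rewrite eq_le; apply/andP; split; last first.
    by apply/ereal_infP => _ [P _ <-].
  rewrite leNgt; apply/negP => c0.
  set c := ereal_inf _ in c0.
  have cle P : models X W P -> (c <= power_probability P n
      [set z | C z (aggregate_discontinuity W (g P) P)])%E.
    by move=> mP; apply: ereal_inf_lbound; exists P.
  have cfin : c \is a fin_num.
    rewrite ge0_fin_numE ?ltW// (le_lt_trans (cle _ mQ))//.
    by rewrite (le_lt_trans (probability_le1 _ (mC _)))// ltry.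
  have r0 : 0 < fine c / 2 by rewrite divr_gt0// fine_gt0// c0 ltey_eq cfin.
  pose A (j : nat) := [set z | C z j%:R].
  pose mu := power_probability Q n.
  (* A null model for the value [j] within total variation [c / 2] covers [j] with probability at
     least [c], so [Q] keeps at least [c / 2]. *)
  have muA j : ((fine c / 2)%:E <= mu (A j))%E.
    have [P [[mP Pj] PQ]] := approx j%:R Q _ (ler0n _ j) mQ r0.
    have := le_trans (cle _ mP) (tv_le_measure PQ (mC _)).
    by rewrite Pj -leeBlDr// -{1}(fineK cfin) -EFinB; congr (_%:E <= _)%E; lra.
  have mF j : measurable (\bigcup_(i in [set i | (j <= i)%N]) A i).
    by apply: bigcup_measurable => i _; exact: mC.
  have mlimA : measurable (lim_sup_set A).
    apply: bigcap_measurable => // i _; exact: mF.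
  (* Each tail union contains some [A j]; continuity from above carries the bound to the event that
     infinitely many integers are covered. *)
  have : ((fine c / 2)%:E <= mu (lim_sup_set A))%E.
    have cvgF := @lim_sup_set_cvg _ _ _ mu A (fun j => mC _).
    rewrite -(cvg_lim _ (cvgF _))//; last first.
      by rewrite (le_lt_trans (probability_le1 _ _)) ?ltry//; exact: mF.
    apply: lime_ge.
      apply/cvg_ex; exists (mu (lim_sup_set A)); apply: cvgF.
      by rewrite (le_lt_trans (probability_le1 _ _)) ?ltry//; exact: mF.
    apply: nearW => j; apply: le_trans (muA j) _.
    apply: le_measure; rewrite ?inE; [exact: mC|exact: mF|].
    by move=> z Az; exists j => /=.
  (* Integrable length is finite almost surely, whereas on this event the length is infinite. *)
  have : mu (lim_sup_set A) = 0%E.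
    have [N [mN N0 HN]] := integrable_ae measurableT (iC _ mQ).
    apply/eqP; rewrite eq_le measure_ge0 andbT -[leRHS]N0.
    apply: le_measure; rewrite ?inE// => z zA.
    apply: HN => /= /(_ I); rewrite set_length_unbounded// => r.
    by have [j rj Aj] := zA r I; exists j.
  by move=> ->; rewrite lee_fin leNgt r0.
Qed.
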